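(* Let $0\neq h\in\mathbb{F}[x]$ and write $h=\lambda u_1^{\alpha_1}\cdots u_t^{\alpha_t}$ with $\lambda\in\mathbb{F}^*$, $\alpha_i\ge1$, and $u_1,\dots,u_t$ distinct monic irreducible polynomials. For every $1\le i\le t$, the ideal $u_iA_h$ is a height one prime ideal of $A_h$ and $A_h/u_iA_h$ is a domain. Moreover: (i) if $\mathrm{char}(\mathbb{F})=0$, the ideals $u_iA_h$ ($1\le i\le t$) are all the height one prime ideals of $A_h$; (ii) if $\mathrm{char}(\mathbb{F})=p>0$, then every irreducible element $z$ of the polynomial algebra $Z(A_h)=\mathbb{F}[x^p,h^py^p]$ which is not of the form $\xi u_i^p$ for any $1\le i\le t$ and $\xi\in\mathbb{F}^*$ generates a height one prime ideal $zA_h$, and the height one prime ideals of $A_h$ are exactly these ideals $zA_h$ together with the ideals $u_iA_h$, $1\le i\le t$.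
   Context: For $h\in\mathbb{F}[x]$, $A_h$ is the unital associative $\mathbb{F}$-algebra generated by $x,\hat y$ with defining relation $\hat yx-x\hat y=h$. Via $x\mapsto x,\hat y\mapsto yh$ it is a subalgebra of the Weyl algebra $A_1$ (generators $x,y$, $yx-xy=1$), and in characteristic $p>0$ its center is the polynomial algebra $\mathbb{F}[x^p,h^py^p]$ (with $h^py^p\in A_h$). Each factor $u_i$ of $h$ is a normal element of $A_h$, so $u_iA_h$ is a two-sided ideal; central elements likewise generate two-sided ideals. The height of a prime ideal $P$ is the supremum of lengths $n$ of chains $P_0\subsetneq P_1\subsetneq\cdots\subsetneq P_n=P$ of prime ideals. *)

(* Defs.v *)
From HB Require Import structures.
From mathcomp Require Import all_boot all_order all_algebra.
Set Implicit Arguments. Unset Strict Implicit. Unset Printing Implicit Defensive.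
Import Order.TTheory GRing.Theory Num.Theory.
Local Open Scope ring_scope.

(* The first Weyl algebra A_1 over F (generators x, y, yx - xy = 1) is     *)
(* represented by normal forms  sum_i f_i(x) y^i  (coefficients on the     *)
(* left), i.e. by elements of {poly {poly F}}: the outer variable 'X is y, *)
(* the inner variable is x.  The (noncommutative) Weyl product is          *)
(*   (f y^i)(g y^j) = sum_k C(i,k) f g^(k) y^(i-k+j)                        *)
(* (since y g = g y + g').  Only the additive structure of {poly {poly F}} *)
(* is used for Weyl elements; the product is weyl_mul.                     *)

Definition weyl_mul (F : fieldType) (a b : {poly {poly F}}) : {poly {poly F}} :=
  \sum_(i < size a) \sum_(j < size b) \sum_(k < i.+1)
     ((a`_i * (b`_j)^`(k)) *+ 'C(i, k))%:P * 'X^(i - k + j).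

Definition weyl_exp (F : fieldType) (a : {poly {poly F}}) (n : nat) :=
  iter n (weyl_mul a) 1.

Definition wx (F : fieldType) : {poly {poly F}} := ('X : {poly F})%:P.
Definition wy (F : fieldType) : {poly {poly F}} := 'X.

(* A_h, realised (via x |-> x, yhat |-> y h) as the unital F-subalgebra    *)
(* of A_1 generated by x and y*h.                                          *)
Inductive in_Ah (F : fieldType) (h : {poly F}) : {poly {poly F}} -> Prop :=
  | Ah_scal (c : F) : in_Ah h (c%:P)%:P
  | Ah_x : in_Ah h (wx F)
  | Ah_yh : in_Ah h (weyl_mul (wy F) h%:P)
  | Ah_add a b : in_Ah h a -> in_Ah h b -> in_Ah h (a + b)
  | Ah_mul a b : in_Ah h a -> in_Ah h b -> in_Ah h (weyl_mul a b).

Definition set_eq (F : fieldType) (I J : {poly {poly F}} -> Prop) :=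
  forall w, I w <-> J w.

Definition ssubset (F : fieldType) (I J : {poly {poly F}} -> Prop) :=
  (forall w, I w -> J w) /\ exists w, J w /\ ~ I w.

Definition is_ideal (F : fieldType) (h : {poly F}) (I : {poly {poly F}} -> Prop) :=
  [/\ forall w, I w -> in_Ah h w,
      I 0,
      forall a b, I a -> I b -> I (a + b) &
      forall a r, in_Ah h r -> I a -> I (weyl_mul r a) /\ I (weyl_mul a r)].

Definition prime_ideal (F : fieldType) (h : {poly F}) (P : {poly {poly F}} -> Prop) :=
  [/\ is_ideal h P,
      exists w, in_Ah h w /\ ~ P w &
      forall a b, in_Ah h a -> in_Ah h b ->
        (forall r, in_Ah h r -> P (weyl_mul (weyl_mul a r) b)) -> P a \/ P b].

Definition height_one (F : fieldType) (h : {poly F}) (P : {poly {poly F}} -> Prop) :=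
  [/\ prime_ideal h P,
      exists P0, prime_ideal h P0 /\ ssubset P0 P &
      ~ exists P0 P1, [/\ prime_ideal h P0, prime_ideal h P1,
                          ssubset P0 P1 & ssubset P1 P]].

Definition quotient_domain (F : fieldType) (h : {poly F}) (I : {poly {poly F}} -> Prop) :=
  [/\ is_ideal h I,
      exists w, in_Ah h w /\ ~ I w &
      forall a b, in_Ah h a -> in_Ah h b -> I (weyl_mul a b) -> I a \/ I b].

(* the ideal r A_h (for r normal/central in A_h it is two-sided) *)
Definition gen_ideal (F : fieldType) (h : {poly F}) (r : {poly {poly F}}) :
  {poly {poly F}} -> Prop :=
  fun w => exists a, in_Ah h a /\ w = weyl_mul r a.

Definition irreducible_elt (R : comUnitRingType) (z : R) :=
  [/\ z != 0, z \isn't a GRing.unit &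
      forall a b, z = a * b -> a \is a GRing.unit \/ b \is a GRing.unit].

(* The polynomial algebra Z(A_h) = F[x^p, h^p y^p] is represented by       *)
(* {poly {poly F}} = F[s][t] (s inner, t outer variable); zeval h p z is    *)
(* the image of z(s,t) under s |-> x^p, t |-> h^p y^p in A_h.              *)
Definition zeval (F : fieldType) (h : {poly F}) (p : nat) (z : {poly {poly F}}) :
  {poly {poly F}} :=
  \sum_(j < size z)
     weyl_mul (z`_j \Po 'X^p)%:P (weyl_exp (weyl_mul (h ^+ p)%:P (weyl_exp (wy F) p)) j).

(* Main.v *)
Require Import Defs.
From mathcomp Require Import all_boot all_order all_algebra ring.
From Stdlib Require Import Classical FunctionalExtensionality PropExtensionality.
Set Implicit Arguments. Unset Strict Implicit. Unset Printing Implicit Defensive.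
Import Order.TTheory GRing.Theory Num.Theory.
Local Open Scope ring_scope.

(** The algebra [A_h] is the set of all [sum_i f_i h^i y^i], i.e. the image of the commutative
    polynomial ring [B = F[x][T]] under the substitution [phi : T |-> h y].  If [u] divides [h u'],
    then [phi (u B)] is a two-sided ideal, and comparing leading coefficients shows that it is
    completely prime as soon as [u] is zero or prime.

    It then suffices to exhibit an antichain of nonzero primes such that every nonzero prime contains
    one of them.  Commutation with [x] is [d/dy], and commutation of [yh] with [f] in [F[x]] is
    [h f'].  In characteristic [0] this puts a nonzero polynomial [g] into any nonzero prime, and for
    [g] of minimal degree [g] divides [h g'], so that some [u_i] divides [g].

    In characteristic [p] left or right multiplication by a central element is the commutative
    product of [B].  For a central [z], commutators and the factor [h^p] reduce any element of an
    ideal to one killed by both partial derivatives modulo [z], and antiderivatives correct it to a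
    central one outside [z A_h], provided that [h^p] is cancellable modulo [z].  With [z = 0] this
    shows that a nonzero prime meets the centre [F[x^p, T^p]], hence contains an irreducible central
    element; with [z] irreducible not dividing [h^p] it shows that [z A_h] is prime.  Finally an
    irreducible central [z] divisible by [u_i] is [u_i] or [u_i^p] up to a scalar. *)

(** * The Weyl product *)

Section Weyl.
Variable F : fieldType.
Implicit Types (a b c w : {poly {poly F}}) (f g : {poly F}).

(** The derivative in [x]; [deriv] on the outer variable is the derivative in [y]. *)
Definition dx : {poly {poly F}} -> {poly {poly F}} := map_poly (@deriv F).

Lemma coef_dx b i : (dx b)`_i = (b`_i)^`().
Proof. exact: coef_map. Qed.

Lemma dxD a b : dx (a + b) = dx a + dx b.
Proof. exact: raddfD. Qed.

Lemma dxB a b : dx (a - b) = dx a - dx b.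
Proof. exact: raddfB. Qed.

Lemma dx0 : dx 0 = 0.
Proof. exact: raddf0. Qed.

Lemma dxM a b : dx (a * b) = dx a * b + a * dx b.
Proof.
apply/polyP => i; rewrite coefD coef_dx !coefM raddf_sum -big_split /=.
by apply: eq_bigr => j _; rewrite derivM !coef_dx.
Qed.

Lemma dxC f : dx f%:P = (f^`())%:P.
Proof.
apply/polyP => i; rewrite coef_dx !coefC.
by case: eqP => _ //; rewrite deriv0.
Qed.

Lemma dxX : dx 'X = 0.
Proof.
apply/polyP => i; rewrite coef_dx coefX coef0.
by case: (i == 1%N); rewrite ?derivC ?deriv0 // -polyC1 derivC.
Qed.

Lemma dx1 : dx 1 = 0.
Proof. by rewrite -[1]/(1%:P) dxC -[1]/(1%:P) derivC polyC0. Qed.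

Lemma dxXn n : dx 'X^n = 0.
Proof.
by elim: n => [|n IH]; rewrite ?dx1 // exprS dxM dxX IH mul0r mulr0 addr0.
Qed.

Lemma dxZ f b : dx (f *: b) = f^`() *: b + f *: dx b.
Proof. by rewrite -!mul_polyC dxM dxC. Qed.

Lemma dxMX b : dx (b * 'X) = dx b * 'X.
Proof. by rewrite dxM dxX mulr0 addr0. Qed.

Lemma deriv_dx b : (dx b)^`() = dx b^`().
Proof.
by apply/polyP => i; rewrite coef_deriv !coef_dx coef_deriv derivMn.
Qed.

(** Left multiplication by [y] on normal forms, from [y f = f y + f']. *)
Definition wD b := b * 'X + dx b.

Lemma wDD a b : wD (a + b) = wD a + wD b.
Proof. by rewrite /wD dxD mulrDl addrACA. Qed.

Lemma wD0 : wD 0 = 0.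
Proof. by rewrite /wD mul0r dx0 addr0. Qed.

Lemma iter_wDD n a b : iter n wD (a + b) = iter n wD a + iter n wD b.
Proof. by elim: n => //= n ->; rewrite wDD. Qed.

Lemma iter_wD0 n : iter n wD 0 = 0.
Proof. by elim: n => //= n ->; rewrite wD0. Qed.

Lemma coef_iter_dx k b j : (iter k dx b)`_j = (b`_j)^`(k).
Proof. by elim: k => [|k IH]; rewrite ?derivn0 // iterS coef_dx IH derivnS. Qed.

(** Multiplication by ['X] commutes with [dx], so this is the binomial formula; the induction uses
    Pascal's rule. *)
Lemma iter_wDE i b :
  iter i wD b = \sum_(k < i.+1) ('X^(i - k) * iter k dx b) *+ 'C(i, k).
Proof.
elim: i => [|i IH]; first by rewrite big_ord1 subn0 expr0 mul1r bin0.
rewrite iterS IH /wD mulr_suml [dx _]raddf_sum -big_split /=.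
have S1 : \sum_(k < i.+1) ('X^(i - k) * iter k dx b) *+ 'C(i, k) * 'X =
          \sum_(k < i.+2) ('X^(i.+1 - k) * iter k dx b) *+ 'C(i, k).
  rewrite [RHS]big_ord_recr /= bin_small // mulr0n addr0.
  apply: eq_bigr => k _; rewrite mulrnAl mulrAC -exprSr subSn //.
  by rewrite -ltnS.
have S2 : \sum_(k < i.+1) dx (('X^(i - k) * iter k dx b) *+ 'C(i, k)) =
          \sum_(k < i.+1) ('X^(i - k) * iter k.+1 dx b) *+ 'C(i, k).
  apply: eq_bigr => k _; rewrite [dx _]raddfMn /= -/(dx _) dxM.
  by rewrite dxXn mul0r add0r.
rewrite big_split /= S1 S2 [RHS]big_ord_recl [in LHS]big_ord_recl /= !bin0 -addrA.
congr (_ + _); rewrite -big_split /=; apply: eq_bigr => k _.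
by rewrite /bump /= add1n subSS binS mulrnDr.
Qed.

(** The left factor acts as an operator in which [y] acts by [wD]. Bilinearity and associativity are
    read off from this form. *)
Lemma weyl_mulE_size a b :
  weyl_mul a b = \sum_(i < size a) a`_i *: iter i wD b.
Proof.
apply: eq_bigr => i _; rewrite iter_wDE exchange_big scaler_sumr /=.
apply: eq_bigr => k _.
have -> : iter k dx b = \sum_(j < size b) (b`_j)^`(k) *: 'X^j.
  apply/polyP => m; rewrite coef_iter_dx coef_sum.
  under eq_bigr do rewrite coefZ coefXn mulr_natr mulrb.
  rewrite -big_mkcond /=; case: (ltnP m (size b)) => hm.
    by rewrite (big_pred1 (Ordinal hm)) // => j /=; rewrite eq_sym.
  rewrite big1 ?(nth_default _ hm) ?linear0 // => j /eqP e.
  by have := ltn_ord j; rewrite -e ltnNge hm.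
rewrite mulr_sumr -!sumrMnl scaler_sumr; apply: eq_bigr => j _.
rewrite polyCMn polyCM mulrnAl -scalerMnr -!mul_polyC exprD.
by congr (_ *+ _); rewrite -!mulrA; congr (_ * _); rewrite mulrCA.
Qed.

Lemma weyl_mulE n a b : (size a <= n)%N ->
  weyl_mul a b = \sum_(i < n) a`_i *: iter i wD b.
Proof.
move=> le; rewrite weyl_mulE_size (big_ord_widen _ (fun i => a`_i *: iter i wD b) le).
rewrite big_mkcond; apply: eq_bigr => i _; case: ltnP => // h.
by rewrite nth_default // scale0r.
Qed.

Lemma weyl_mulDl a b c : weyl_mul (a + b) c = weyl_mul a c + weyl_mul b c.
Proof.
pose n := maxn (size a) (size b).
rewrite (weyl_mulE c (n:=n)) ?size_polyD // (weyl_mulE c (n:=n) (a:=a)) ?leq_maxl //.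
rewrite (weyl_mulE c (n:=n) (a:=b)) ?leq_maxr // -big_split.
by apply: eq_bigr => i _; rewrite coefD scalerDl.
Qed.

Lemma weyl_mulDr a b c : weyl_mul a (b + c) = weyl_mul a b + weyl_mul a c.
Proof.
rewrite !weyl_mulE_size -big_split; apply: eq_bigr => i _.
by rewrite iter_wDD scalerDr.
Qed.

Lemma weyl_mul0l b : weyl_mul 0 b = 0.
Proof. by rewrite weyl_mulE_size size_poly0 big_ord0. Qed.

Lemma weyl_mul0r a : weyl_mul a 0 = 0.
Proof. by rewrite weyl_mulE_size big1 // => i _; rewrite iter_wD0 scaler0. Qed.

Lemma weyl_mulNl a b : weyl_mul (- a) b = - weyl_mul a b.
Proof.
apply/eqP; rewrite -subr_eq0 opprK -weyl_mulDl.
by rewrite addNr weyl_mul0l.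
Qed.

Lemma weyl_mulCl f b : weyl_mul f%:P b = f *: b.
Proof. by rewrite (weyl_mulE (n:=1)) ?size_polyC_leq1 // big_ord1 coefC. Qed.

Lemma weyl_mul1l b : weyl_mul 1 b = b.
Proof. by rewrite -polyC1 weyl_mulCl scale1r. Qed.

Lemma weyl_mulXl b : weyl_mul 'X b = wD b.
Proof.
rewrite (weyl_mulE (n:=2)) ?size_polyX // !big_ord_recl big_ord0 !coefX /=.
by rewrite scale0r scale1r add0r addr0.
Qed.

Lemma weyl_mulZl f a b : weyl_mul (f *: a) b = f *: weyl_mul a b.
Proof.
rewrite (weyl_mulE (n:=size a)) ?size_scale_leq // weyl_mulE_size scaler_sumr.
by apply: eq_bigr => i _; rewrite coefZ scalerA.
Qed.

Lemma weyl_mul_sum n (a : 'I_n -> {poly {poly F}}) c :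
  weyl_mul (\sum_(i < n) a i) c = \sum_(i < n) weyl_mul (a i) c.
Proof. exact: (big_morph (fun a => weyl_mul a c) (fun a b => weyl_mulDl a b c) (weyl_mul0l c)). Qed.

Lemma weyl_mulMX a b : weyl_mul (a * 'X) b = weyl_mul a (wD b).
Proof.
rewrite (weyl_mulE (n:=(size a).+1)); last first.
  by apply: leq_trans (size_polyMleq _ _) _; rewrite size_polyX addn2.
rewrite big_ord_recl coefMX /= scale0r add0r weyl_mulE_size.
by apply: eq_bigr => i _; rewrite coefMX /= -iterS -iterSr.
Qed.

(** Associativity when the leftmost factor is [y]; the general case follows by iteration and
    linearity. *)
Lemma weyl_mul_wD b c : weyl_mul (wD b) c = wD (weyl_mul b c).
Proof.
rewrite weyl_mulDl weyl_mulMX (weyl_mulE (n:=size b) (a:=dx b)); last first.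
  exact: size_poly.
rewrite !weyl_mulE_size (big_morph wD wDD wD0) -big_split /=.
apply: eq_bigr => i _; rewrite /wD dxZ coef_dx -iterSr iterS /wD.
by rewrite scalerDr scalerAl -addrA; congr (_ + _); rewrite addrC.
Qed.

Lemma weyl_mulA a b c : weyl_mul a (weyl_mul b c) = weyl_mul (weyl_mul a b) c.
Proof.
rewrite [in LHS]weyl_mulE_size [in RHS](weyl_mulE_size a b) weyl_mul_sum.
apply: eq_bigr => i _; rewrite weyl_mulZl; congr (_ *: _).
by elim: (i : nat) => //= n ->; rewrite weyl_mul_wD.
Qed.

Lemma iter_wD_const n w : dx w = 0 -> iter n wD w = w * 'X^n.
Proof.
move=> e; elim: n => [|n IH]; first by rewrite mulr1.
rewrite iterS IH /wD dxM e mul0r add0r.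
by rewrite dxXn mulr0 addr0 -mulrA -exprSr.
Qed.

Lemma weyl_mul_constr a w : dx w = 0 -> weyl_mul a w = a * w.
Proof.
move=> e; rewrite weyl_mulE_size -[X in _ = X * _]coefK poly_def mulr_suml.
by apply: eq_bigr => i _; rewrite iter_wD_const // -scalerAl mulrC.
Qed.

Lemma weyl_mul1r a : weyl_mul a 1 = a.
Proof. by rewrite weyl_mul_constr ?mulr1 // dx1. Qed.

End Weyl.

(** * The subalgebra [A_h] and its ideals generated by polynomials *)

Section Subalgebra.
Variables (F : fieldType) (h : {poly F}).
Hypothesis h_neq0 : h != 0.
Implicit Types (a b c w : {poly {poly F}}) (f g u : {poly F}).

Definition phi b := b \Po (h *: 'X).

Lemma coef_phi b i : (phi b)`_i = b`_i * h ^+ i.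
Proof.
rewrite /phi comp_polyE coef_sum.
under eq_bigr do rewrite exprZn scalerA coefZ coefXn mulr_natr mulrb.
rewrite -big_mkcond /=; case: (ltnP i (size b)) => hm.
  by rewrite (big_pred1 (Ordinal hm)) // => j /=; rewrite eq_sym.
rewrite big1 ?(nth_default _ hm) ?mul0r // => j /eqP e.
by have := ltn_ord j; rewrite -e ltnNge hm.
Qed.

Lemma phiD a b : phi (a + b) = phi a + phi b.
Proof. exact: raddfD. Qed.
Lemma phiB a b : phi (a - b) = phi a - phi b.
Proof. exact: raddfB. Qed.
Lemma phi0 : phi 0 = 0.
Proof. exact: raddf0. Qed.
Lemma phi1 : phi 1 = 1.
Proof. exact: rmorph1. Qed.
Lemma phiM a b : phi (a * b) = phi a * phi b.
Proof. exact: rmorphM. Qed.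
Lemma phiC f : phi f%:P = f%:P.
Proof. exact: comp_polyC. Qed.
Lemma phiX : phi 'X = h *: 'X.
Proof. exact: comp_polyX. Qed.
Lemma phiZ f b : phi (f *: b) = f *: phi b.
Proof. exact: linearZ. Qed.

Lemma phi_inj : injective phi.
Proof.
move=> a b e; apply/polyP => i; apply: (@mulIf _ (h ^+ i)); rewrite ?expf_neq0 //.
by rewrite -!coef_phi e.
Qed.

Lemma size_phi b : size (phi b) = size b.
Proof.
apply/eqP; rewrite eqn_leq; apply/andP; split; apply/leq_sizeP => i le.
  by rewrite coef_phi nth_default // mul0r.
have /eqP := congr1 (fun w => w`_i) (erefl (phi b)).
rewrite [X in X == _]nth_default // coef_phi eq_sym mulf_eq0 expf_eq0 (negPf h_neq0).
by rewrite andbF orbF => /eqP.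
Qed.

(** The derivation of [B] that [phi] turns into [h] times [dx]: the second summand comes from
    differentiating the powers of [h] that [phi] inserts. *)
Definition yhder b := h *: dx b + h^`() *: ('X * b^`()).

Lemma scale_dx_phi b : h *: dx (phi b) = phi (yhder b).
Proof.
apply/polyP => i; rewrite coefZ coef_dx !coef_phi derivM deriv_exp.
rewrite /yhder coefD !coefZ coef_dx coefXM.
case: i => [|i] /=; first by rewrite !mulr0n !mulr0 addr0 mulr1 addr0 mulr1.
rewrite coef_deriv exprS /=.
by move: (b`_i.+1) => b1; move: (h ^+ i) (i.+1) (b1^`()) (h^`()) => hi n b2 h1; ring.
Qed.

(** Left multiplication by the generator [y h], pulled back along [phi]; the middle term comes from
    [y h = h y + h']. *)
Definition yh b := 'X * b + h^`() *: b + yhder b.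

Lemma weyl_mul_yh b :
  weyl_mul (weyl_mul (wy F) h%:P) (phi b) = phi (yh b).
Proof.
rewrite -weyl_mulA weyl_mulCl weyl_mulXl /wD dxZ scale_dx_phi /yh !phiD phiM phiX.
by rewrite !phiZ -!scalerAl [_ * 'X]mulrC addrA.
Qed.

Lemma in_Ah_opp w : in_Ah h w -> in_Ah h (- w).
Proof.
move=> iw; have := Ah_mul (Ah_scal h (-1)) iw.
by rewrite weyl_mulCl !polyCN scaleNr scale1r.
Qed.

Lemma in_AhC f : in_Ah h f%:P.
Proof.
elim/poly_ind: f => [|f c IH]; first exact: (Ah_scal h 0).
rewrite polyCD; apply: Ah_add; last exact: Ah_scal.
by rewrite polyCM mul_polyC -weyl_mulCl; apply: Ah_mul => //; apply: Ah_x.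
Qed.

(** Induction on the degree in [T]: [T b] differs from [yh b], a multiple of the generator, by terms
    of degree at most that of [b]. *)
Lemma in_Ah_phi b : in_Ah h (phi b).
Proof.
have [n] := ubnP (size b); elim: n b => // n IH b.
elim/poly_ind: b => [|b c _]; first by move=> _; rewrite phi0; apply: (in_AhC 0).
rewrite phiD phiC size_MXaddC => lt; apply: Ah_add; last exact: in_AhC.
have [-> | bn0] := eqVneq b 0; first by rewrite mul0r phi0; apply: (in_AhC 0).
move: lt; rewrite (negPf bn0) /= ltnS => lt.
have -> : b * 'X = yh b - h^`() *: b - yhder b by rewrite /yh; ring.
rewrite !phiB -weyl_mul_yh; apply: Ah_add; last first.
  apply: in_Ah_opp; apply: IH; apply: leq_ltn_trans lt.
  apply: leq_trans (size_polyD _ _) _; rewrite geq_max !(leq_trans (size_scale_leq _ _)) //.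
    apply: leq_trans (size_polyMleq _ _) _; rewrite size_polyX add2n /=.
    exact: lt_size_deriv.
  exact: size_poly.
apply: Ah_add; first by apply: Ah_mul; [apply: Ah_yh | apply: IH].
by apply: in_Ah_opp; rewrite phiZ -weyl_mulCl; apply: Ah_mul; [apply: in_AhC | apply: IH].
Qed.

(* With [u = 1] this shows that [A_h] is contained in the image of [phi]. *)
Lemma Ah_mul_stable u r b : u %| h * u^`() -> in_Ah h r ->
  exists c, weyl_mul r (phi (u *: b)) = phi (u *: c).
Proof.
case/dvdpP => k hk ir; elim: ir b => {r} [c|||r s _ IHr _ IHs|r s _ IHr _ IHs] b.
- by exists (c%:P *: b); rewrite weyl_mulCl -phiZ !scalerA mulrC.
- by exists ('X *: b); rewrite weyl_mulCl -phiZ !scalerA mulrC.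
(* By the Leibniz rule, [yh] commutes with the factor [u] up to [h u' b], which is [u k b]. *)
- rewrite weyl_mul_yh; exists (yh b + k *: b); congr phi.
  rewrite /yh /yhder dxZ derivZ -!mul_polyC.
  by have := congr1 polyC hk; rewrite !polyCM => e; ring: e.
- have [c hc] := IHr b; have [d hd] := IHs b; exists (c + d).
  by rewrite weyl_mulDl hc hd -phiD scalerDr.
- have [d hd] := IHs b; have [c hc] := IHr d; exists c.
  by rewrite -weyl_mulA hd.
Qed.

Lemma in_AhP w : in_Ah h w <-> exists b, w = phi b.
Proof.
split=> [iw|[b ->]]; last exact: in_Ah_phi.
have [|c] := @Ah_mul_stable 1 w 1 _ iw; first exact: dvd1p.
by rewrite !scale1r phi1 weyl_mul1r; exists c.
Qed.

Lemma in_Ah0 : in_Ah h 0.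
Proof. exact: (in_AhC 0). Qed.
Lemma in_Ah1 : in_Ah h 1.
Proof. exact: (in_AhC 1). Qed.

Lemma gen_idealC u w : gen_ideal h u%:P w <-> exists b, w = phi (u *: b).
Proof.
split=> [[a [/in_AhP[b ->] ->]]|[b ->]].
  by exists b; rewrite weyl_mulCl phiZ.
by exists (phi b); split; [apply: in_Ah_phi | rewrite weyl_mulCl phiZ].
Qed.

Lemma gen_idealC_ideal u : u %| h * u^`() -> is_ideal h (gen_ideal h u%:P).
Proof.
move=> hu; split.
- by move=> w /gen_idealC[b ->]; apply: in_Ah_phi.
- by apply/gen_idealC; exists 0; rewrite scaler0 phi0.
- move=> a b /gen_idealC[c ->] /gen_idealC[d ->]; apply/gen_idealC.
  by exists (c + d); rewrite scalerDr phiD.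
- move=> a r ir /gen_idealC[c ->]; split; apply/gen_idealC.
    exact: Ah_mul_stable.
  have /in_AhP[d hd] : in_Ah h (weyl_mul (phi c) r).
    by apply: Ah_mul => //; apply: in_Ah_phi.
  by exists d; rewrite !phiZ -hd weyl_mulZl.
Qed.

Lemma phi_scale_inj u b c : phi (u *: b) = phi c -> forall i, u %| c`_i.
Proof. by move/phi_inj=> <- i; rewrite coefZ dvdp_mulr. Qed.

Lemma dvd_coef_scale u c : (forall i, u %| c`_i) -> exists b, c = u *: b.
Proof.
move=> hc; exists (map_poly (fun f => f %/ u) c); apply/polyP => i.
by rewrite coefZ coef_map_id0 ?div0p // mulrC divpK.
Qed.

(** [wD] raises the degree by one and keeps the leading coefficient, so the top term is that of the
    commutative product. *)
Lemma coef_weyl_mul_lead a b m n : (size a <= m.+1)%N -> (size b <= n.+1)%N ->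
  (weyl_mul a b)`_(m + n) = a`_m * b`_n.
Proof.
move=> sa sb; have sD k : (size (iter k (@wD F) b) <= n.+1 + k)%N.
  elim: k => [|k IH]; first by rewrite addn0.
  rewrite iterS /wD; apply: leq_trans (size_polyD _ _) _; rewrite geq_max; apply/andP; split.
    by apply: leq_trans (size_polyMleq _ _) _; rewrite size_polyX addn2 addnS ltnS.
  rewrite addnS; apply: leqW; apply: leq_trans (size_poly _ _) IH.
have lD k : (iter k (@wD F) b)`_(n + k) = b`_n.
  elim: k => [|k IH]; first by rewrite addn0.
  rewrite iterS {1}/wD coefD addnS coefMX /= IH coef_dx [X in X^`()]nth_default ?deriv0 ?addr0 //.
rewrite (weyl_mulE (n:=m.+1)) // coef_sum big_ord_recr /= coefZ addnC lD big1 ?add0r //.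
move=> i _; rewrite coefZ [X in _ * X]nth_default ?mulr0 //; apply: leq_trans (sD i) _.
by rewrite addSn ltn_add2l.
Qed.

(* To be used for [u = 0], where it says that [A_h] is a domain, and for [u] a factor of [h]. *)
Lemma gen_idealC_domain u :
  u %| h * u^`() -> ~~ (u %| 1) ->
  (forall f g, u %| f * g -> u %| f \/ u %| g) ->
  quotient_domain h (gen_ideal h u%:P).
Proof.
move=> hu u1 pru; have idu := gen_idealC_ideal hu; split=> //.
  exists 1; split; first exact: in_Ah1.
  move/gen_idealC=> [b]; rewrite -phi1 => /esym/phi_scale_inj/(_ 0%N).
  by rewrite coefC /=; apply/negP.
move=> _ _ /in_AhP[a ->] /in_AhP[b ->].
have [_ _ addI mulI] := idu.
have genP c : (forall i, u %| c`_i) -> gen_ideal h u%:P (phi c).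
  by case/dvd_coef_scale => d ->; apply/gen_idealC; exists d.
(* Induction on the total size: a leading term whose coefficient is divisible by [u] lies in the
   ideal and can be removed. *)
have [n] := ubnP (size a + size b)%N; elim: n a b => // n IH a b lt.
have step c : c != 0 -> u %| lead_coef c -> exists d : {poly {poly F}}, [/\ (size d < size c)%N,
    gen_ideal h u%:P (phi (c - d)) & gen_ideal h u%:P (phi (d - c))].
  move=> cn0 ul; exists (c - lead_coef c *: 'X^((size c).-1)); split.
  - have sc := size_poly_gt0 c; rewrite cn0 in sc.
    rewrite -[in X in (_ < X)%N](prednK sc) ltnS; apply/leq_sizeP => j.
    rewrite coefB coefZ coefXn leq_eqVlt => /orP[/eqP <-|lj].
      by rewrite eqxx mulr1 subrr.
    rewrite gtn_eqF // mulr0 subr0 nth_default //; by rewrite -(prednK sc).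
  - by apply: genP => j; rewrite subKr coefZ dvdp_mulr.
  - by apply: genP => j; rewrite addrAC subrr sub0r coefN dvdpNr coefZ dvdp_mulr.
have in0 : gen_ideal h u%:P (phi 0) by apply: genP => i; rewrite coef0 dvdp0.
have [-> | an0] := eqVneq a 0; first by left.
have [-> | bn0] := eqVneq b 0; first by right.
have sa := size_poly_gt0 a; rewrite an0 in sa.
have sb := size_poly_gt0 b; rewrite bn0 in sb.
case: (boolP (u %| lead_coef a)) => ula.
  have [d [sd d1 d2]] := step _ an0 ula => /(addI _ _).
  have /mulI/(_ d2)[_] := in_Ah_phi b.
  move=> e /(_ _ e); rewrite -weyl_mulDl -phiD addrC subrK => hd.
  have [|//|] := IH d b _ hd; last by right.
    by apply: leq_trans (_ : size a + size b <= n)%N; rewrite ?ltn_add2r // -ltnS.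
  by move=> gd; left; have := addI _ _ gd d1; rewrite -phiD addrC subrK.
case: (boolP (u %| lead_coef b)) => ulb.
  have [d [sd d1 d2]] := step _ bn0 ulb => /(addI _ _).
  have /mulI/(_ d2)[e _] := in_Ah_phi a.
  move=> /(_ _ e); rewrite -weyl_mulDr -phiD addrC subrK => hd.
  have [|//|] := IH a d _ hd; first 2 last.
  - by move=> gd; right; have := addI _ _ gd d1; rewrite -phiD addrC subrK.
  - by apply: leq_trans (_ : size a + size b <= n)%N; rewrite ?ltn_add2l // -ltnS.
  - by left.
(* Now [u] divides neither leading coefficient; comparing top coefficients and cancelling the power
   of [h] contradicts [pru]. *)
move/gen_idealC => [c hc]; exfalso.
have := congr1 (fun w => w`_((size a).-1 + (size b).-1)) hc.
rewrite /= coef_weyl_mul_lead ?size_phi ?prednK // !coef_phi -!lead_coefE exprD coefZ.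
rewrite mulrACA => /mulIf; rewrite mulf_eq0 !expf_eq0 (negPf h_neq0) !andbF => /(_ isT) e.
have /pru[] : u %| lead_coef a * lead_coef b by rewrite e dvdp_mulr.
  by apply/negP.
by apply/negP.
Qed.

Lemma domain_prime I : quotient_domain h I -> prime_ideal h I.
Proof.
case=> [idI prI dI]; split=> // a b ia ib /(_ 1 in_Ah1).
by rewrite weyl_mul1r; apply: dI.
Qed.

Lemma gen_ideal0 w : gen_ideal h 0%:P w <-> w = 0.
Proof.
split=> [/gen_idealC[b ->]|->]; first by rewrite scale0r phi0.
by apply/gen_idealC; exists 0; rewrite scaler0 phi0.
Qed.

Lemma Ah_domain : quotient_domain h (gen_ideal h 0%:P).
Proof.
apply: gen_idealC_domain; first by rewrite deriv0 mulr0 dvdpp.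
  by rewrite dvd0p oner_eq0.
by move=> f g; rewrite !dvd0p mulf_eq0 => /orP.
Qed.

Lemma irreducible_dvdM u f g : irreducible_poly u ->
  u %| f * g -> u %| f \/ u %| g.
Proof.
move=> iu ufg; case: (boolP (u %| f)) => [|nf]; [by left | right].
by move: ufg; rewrite Gauss_dvdpr // irreducible_poly_coprime.
Qed.

Lemma irreducible_dvd1 u : irreducible_poly u -> ~~ (u %| 1).
Proof. by case=> su _; rewrite dvdp1 neq_ltn su orbT. Qed.

Lemma factor_domain u : irreducible_poly u -> u %| h ->
  quotient_domain h (gen_ideal h u%:P).
Proof.
move=> iu uh; apply: gen_idealC_domain; first exact: dvdp_mulr.
  exact: irreducible_dvd1.
by move=> f g; apply: irreducible_dvdM.
Qed.

(** [u] is normal: every [r u] has the form [u c], so [g r u] is a right multiple of [u g] for all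
    [r]. *)
Lemma prime_factor P u g : prime_ideal h P -> u %| h ->
  P (u * g)%:P -> P u%:P \/ P g%:P.
Proof.
case=> [[Pin P0 PD PM] _ Ppr] uh Pug; apply/or_comm.
apply: Ppr; try exact: in_AhC.
move=> r ir; have [c] := @Ah_mul_stable u r 1 (dvdp_mulr _ uh) ir.
rewrite phiZ phi1 -[u *: 1]mul_polyC mulr1 -weyl_mulA => ->.
rewrite phiZ -weyl_mulCl weyl_mulA; apply: (proj2 (PM _ _ (in_Ah_phi c) _)).
by rewrite weyl_mulCl -mul_polyC -polyCM mulrC.
Qed.

Lemma idealB I a b : is_ideal h I -> I a -> I b -> I (a - b).
Proof.
case=> [Iin I0 ID IM] Ia Ib; apply: ID => //.
have [] := IM b (- 1%:P) _ Ib; first by apply: in_Ah_opp; apply: in_AhC.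
by rewrite weyl_mulNl weyl_mulCl scale1r.
Qed.

Lemma weyl_mul_x w : weyl_mul w (wx F) = 'X *: w + w^`().
Proof.
elim/poly_ind: w => [|w f IH]; first by rewrite weyl_mul0l scaler0 deriv0 addr0.
rewrite weyl_mulDl weyl_mulMX weyl_mulCl.
rewrite /wD dxC derivX weyl_mulDr weyl_mul1r.
have -> : weyl_mul w (wx F * 'X) = weyl_mul w (wx F) * 'X.
  rewrite !weyl_mulE_size mulr_suml; apply: eq_bigr => i _; rewrite -scalerAl; congr (_ *: _).
  by elim: (i : nat) => //= n ->; rewrite /wD dxMX mulrDl.
rewrite IH derivD derivC derivM derivX -!mul_polyC /wx; ring.
Qed.

(** The derivative in [y] is the commutator with [x]. *)
Lemma ideal_deriv I w : is_ideal h I -> I w -> I w^`().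
Proof.
move=> idI Iw; have [_ _ _ IM] := idI.
have [I1 I2] := IM w _ (Ah_x h) Iw.
have := idealB idI I2 I1; rewrite weyl_mul_x weyl_mulCl.
by rewrite addrAC subrr add0r.
Qed.

Lemma ideal_scale I f w : is_ideal h I -> I w -> I (f *: w).
Proof.
by case=> _ _ _ IM /(IM _ _ (in_AhC f))[]; rewrite weyl_mulCl.
Qed.

(* [yh w - w yh = h dx w] when [w] commutes with [x]. *)
Lemma ideal_dx I w : is_ideal h I -> I w ->
  (forall f, weyl_mul w f%:P = f *: w) -> I (h *: dx w).
Proof.
move=> idI Iw cw; have [_ _ _ IM] := idI.
have [I1 I2] := IM w _ (Ah_yh h) Iw.
have := idealB idI I1 I2; rewrite -weyl_mulA weyl_mulCl weyl_mulXl.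
rewrite weyl_mulXl /wD dxC weyl_mulDr cw dxZ.
have -> : weyl_mul w (h%:P * 'X) = h *: w * 'X.
  rewrite -cw !weyl_mulE_size mulr_suml; apply: eq_bigr => i _; rewrite -scalerAl; congr (_ *: _).
  by elim: (i : nat) => //= n ->; rewrite /wD dxMX mulrDl.
set z := (X in I X); suff -> : z = h *: dx w by [].
by rewrite /z; ring.
Qed.

End Subalgebra.

(** * Height one primes and characteristic zero *)

Section HeightOne.
Variables (F : fieldType) (h : {poly F}).
Hypothesis h_neq0 : h != 0.
Implicit Types (P Q : {poly {poly F}} -> Prop).

Lemma set_eq_eq P Q : set_eq P Q -> P = Q.
Proof.
by move=> e; apply: functional_extensionality => w; apply: propositional_extensionality.
Qed.

(** Since [0] is prime, a height one prime cannot lie strictly above a member of [L], so it equals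
    the one it contains. Conversely, a nonzero prime strictly inside a member [Q] would contain a
    member, which by the last hypothesis contains [Q]. *)
Lemma height_oneP (L : ({poly {poly F}} -> Prop) -> Prop) :
  (forall Q, L Q -> prime_ideal h Q) ->
  (forall Q, L Q -> exists w, Q w /\ w <> 0) ->
  (forall P, prime_ideal h P -> (exists w, P w /\ w <> 0) ->
     exists Q, L Q /\ forall w, Q w -> P w) ->
  (forall Q Q', L Q -> L Q' -> (forall w, Q w -> Q' w) -> forall w, Q' w -> Q w) ->
  forall P, height_one h P <-> exists Q, L Q /\ set_eq P Q.
Proof.
move=> Lprime Lneq0 Lmin Lanti.
have P0 := domain_prime (Ah_domain h_neq0).
have ideal_0 P : prime_ideal h P -> P 0 by case=> [[]].
have ssub_neq0 P Q : prime_ideal h P -> ssubset P Q -> exists w, Q w /\ w <> 0.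
  by move=> /ideal_0 PP [_ [w [Qw nPw]]]; exists w; split=> // w0; rewrite w0 in nPw.
have zero_ssub Q : prime_ideal h Q -> (exists w, Q w /\ w <> 0) ->
    ssubset (gen_ideal h 0%:P) Q.
  move=> /ideal_0 Q0 [w [Qw wn0]]; split; first by move=> v /gen_ideal0 ->.
  by exists w; split=> // /gen_ideal0.
move=> P; split.
- case=> [pP [P' [pP' P'P]] nch].
  have Pn0 := ssub_neq0 _ _ pP' P'P.
  have [Q [LQ QP]] := Lmin P pP Pn0; exists Q; split=> // w; split; last exact: QP.
  move=> Pw; apply: NNPP => nQw; apply: nch; exists (gen_ideal h 0%:P), Q.
  split=> //; [exact: Lprime | exact: zero_ssub (Lprime _ LQ) (Lneq0 _ LQ) |].
  by split=> //; exists w.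
- case=> Q [LQ /set_eq_eq ->].
  split; first exact: Lprime.
    by exists (gen_ideal h 0%:P); split=> //; apply: zero_ssub (Lprime _ LQ) (Lneq0 _ LQ).
  case=> [P' [P1 [pP' pP1 P'P1 [P1Q [w [Qw nP1w]]]]]].
  have [Q' [LQ' Q'P1]] := Lmin P1 pP1 (ssub_neq0 _ _ pP' P'P1).
  apply: nP1w; apply: (Q'P1); apply: Lanti Qw => // v /Q'P1; exact: P1Q.
Qed.

End HeightOne.

(** * The ideals generated by the prime factors of [h] *)

Section Factors.
Variables (F : fieldType) (h : {poly F}) (lam : F) (t : nat)
    (u : 'I_t -> {poly F}) (alpha : 'I_t -> nat).
Hypotheses (h_neq0 : h != 0) (u_monic : forall i, u i \is monic)
  (u_irr : forall i, irreducible_poly (u i)) (u_inj : injective u)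
  (alpha_gt0 : forall i, (0 < alpha i)%N)
  (h_fact : h = lam%:P * \prod_(i < t) u i ^+ alpha i).

Lemma factor_dvd i : u i %| h.
Proof.
rewrite h_fact (bigD1 i) //= mulrCA dvdp_mulr //.
by rewrite -(prednK (alpha_gt0 i)) exprS dvdp_mulr.
Qed.

Lemma factor_dvd_eq i j : u i %| u j -> i = j.
Proof.
move=> uij; apply: u_inj; apply/eqP; rewrite -eqp_monic //.
by apply: apply_irredp uij => //; have [s _] := u_irr i; rewrite neq_ltn s orbT.
Qed.

Lemma coprime_factors f : (forall i, ~~ (u i %| f)) -> coprimep f h.
Proof.
move=> nf; have ln0 : lam != 0.
  by apply: contraNneq h_neq0 => l0; rewrite h_fact l0 mul0r.
rewrite h_fact mul_polyC coprimepZr //.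
elim/big_ind: _ => [|a b ca cb|i _]; first exact: coprimep1.
  by rewrite coprimepMr ca.
by rewrite coprimep_expr // coprimep_sym irreducible_poly_coprime.
Qed.

Lemma factor_prime i : prime_ideal h (gen_ideal h (u i)%:P).
Proof. by apply: domain_prime; apply: factor_domain => //; apply: factor_dvd. Qed.

Lemma factor_ideal_neq0 i : exists w, gen_ideal h (u i)%:P w /\ w <> 0.
Proof.
exists (u i)%:P; split.
  by apply/gen_idealC => //; exists 1; rewrite phiZ phi1 -mul_polyC mulr1.
by apply/eqP; rewrite polyC_eq0 irredp_neq0.
Qed.

Lemma gen_ideal_self v : gen_ideal h v v.
Proof. by exists 1; split; [apply: in_Ah1 | rewrite weyl_mul1r]. Qed.

Lemma gen_ideal_sub P v : prime_ideal h P -> P v ->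
  forall w, gen_ideal h v w -> P w.
Proof. by case=> [[_ _ _ PM] _ _] Pv w [a [ia ->]]; have [] := PM v a ia Pv. Qed.

Lemma factor_ideal_dvd i f : gen_ideal h (u i)%:P f%:P -> u i %| f.
Proof.
move/gen_idealC => [b]; rewrite -(phiC h f) => /esym/(phi_scale_inj h_neq0)/(_ 0%N).
by rewrite coefC.
Qed.

(** * Classification in characteristic zero *)

Section CharZero.
Hypothesis char0 : [pchar F] =i pred0.

Lemma deriv_eq0_char0 (g : {poly F}) : g^`() = 0 -> (size g <= 1)%N.
Proof.
move=> g0; apply/leq_sizeP => -[|j] // _; have /eqP := congr1 (fun f : {poly F} => f`_j) g0.
by rewrite coef_deriv coef0 -mulr_natr mulf_eq0 ((proj1 (pcharf0P F)) char0) orbF => /eqP.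
Qed.

(** Descent on the degree: the remainder of [h g'] modulo [g] is again in [P]. If it vanishes,
    either some [u i] splits off from [g], or [g] is prime to [h] and divides [g'], so that [g] is
    constant and [P] is not proper. *)
Lemma prime_poly_char0 P g : prime_ideal h P -> g != 0 -> P g%:P ->
  exists i, P (u i)%:P.
Proof.
move=> pP; have [idP [w [iw nPw]] _] := pP; have [Pin P0 PD PM] := idP.
have [n] := ubnP (size g); elim: n g => // n IH g lt gn0 Pg.
case: (boolP (g %| h * g^`())) => [gh|ngh]; last first.
  apply: (IH ((h * g^`()) %% g)) => //.
    by rewrite -ltnS; apply: leq_trans lt; rewrite ltnS ltn_modp.
  have -> : (h * g^`()) %% g = h * g^`() - (h * g^`()) %/ g * g.
    by rewrite {2}(divp_eq (h * g^`()) g) addrAC subrr add0r.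
  rewrite polyCB; apply: (idealB idP); rewrite polyCM mul_polyC.
    rewrite -dxC; apply: ideal_dx => // f.
    by rewrite weyl_mulCl -!mul_polyC mulrC.
  exact: (ideal_scale _ idP Pg).
case: (boolP [exists i, u i %| g]) => [/existsP[i /dvdpP[g1 g_eq]]|].
  have : P (u i * g1)%:P by rewrite mulrC -g_eq.
  case/(prime_factor pP (factor_dvd i)); first by exists i.
  move=> Pg1; have g1n0 : g1 != 0 by apply: contraNneq gn0 => e; rewrite g_eq e mul0r.
  apply: (IH g1) => //; rewrite -ltnS; apply: leq_trans lt.
  rewrite g_eq ltnS size_mul ?(irredp_neq0 (u_irr i)) //.
  have [s _] := u_irr i; rewrite -(prednK (ltnW s)) addnS /= -addn1 leq_add2l.
  by rewrite -ltnS prednK // ltnW.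
rewrite negb_exists => /forallP /coprime_factors cop.
move: gh; rewrite Gauss_dvdpr // => gg'.
have g0 : g^`() = 0.
  apply/eqP; apply: contraTT gg' => g'n0; rewrite gtNdvdp //.
  exact: lt_size_deriv.
have := deriv_eq0_char0 g0 => /size1_polyC g_eq; case: nPw.
have cn0 : g`_0 != 0 by apply: contraNneq gn0 => e; rewrite g_eq e.
have := ideal_scale (g`_0)^-1%:P idP Pg; rewrite {2}g_eq -mul_polyC -!polyCM mulVf // => P1.
by rewrite -[w]weyl_mul1l; have [] := PM _ _ iw P1.
Qed.

(** Differentiating in [y] lowers the degree without reaching zero, until a nonzero polynomial in
    [x] is left. *)
Lemma prime_neq0_char0 P : prime_ideal h P -> (exists w, P w /\ w <> 0) ->
  exists i, P (u i)%:P.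
Proof.
move=> pP [w [Pw /eqP wn0]]; have [idP _ _] := pP.
have [n] := ubnP (size w); elim: n w Pw wn0 => // n IH w Pw wn0 lt.
have [/size1_polyC w_eq|s] := leqP (size w) 1.
  apply: (@prime_poly_char0 P w`_0) => //; last by rewrite -w_eq.
  by apply: contraNneq wn0 => e; rewrite w_eq e.
apply: (IH w^`()); first exact: (ideal_deriv idP Pw).
  have /eqP : lead_coef w != 0 by rewrite lead_coef_eq0.
  apply: contra_notN => /eqP/(congr1 (fun v : {poly {poly F}} => v`_(size w).-2)).
  rewrite coef_deriv coef0 lead_coefE; case: (size w) s => // -[|m] // _ /=.
  move/eqP; rewrite -mulr_natr mulf_eq0 -polyC_natr polyC_eq0 ((proj1 (pcharf0P F)) char0) orbF.
  by move/eqP.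
by rewrite -ltnS; apply: leq_trans lt; rewrite ltnS lt_size_deriv.
Qed.

Lemma height_one_char0 P :
  height_one h P <-> exists i, set_eq P (gen_ideal h (u i)%:P).
Proof.
pose L Q := exists i, Q = gen_ideal h (u i)%:P.
have [||||f g] := @height_oneP F h h_neq0 L _ _ _ _ P.
- by move=> _ [i ->]; apply: factor_prime.
- by move=> _ [i ->]; apply: factor_ideal_neq0.
- move=> Q pQ /(prime_neq0_char0 pQ)[i Qi]; exists (gen_ideal h (u i)%:P).
  by split; [exists i | apply: gen_ideal_sub].
- move=> _ _ [i ->] [j ->] sub.
  by have /factor_ideal_dvd/factor_dvd_eq -> := sub _ (gen_ideal_self _).
split=> [/f[_ [[i ->] e]]|[i e]]; first by exists i.
by apply: g; exists (gen_ideal h (u i)%:P); split=> //; exists i.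
Qed.

End CharZero.
End Factors.

(** * Central elements in characteristic [p] *)

(** Exact divisibility: on [{poly {poly F}}] the relation [%|] only means divisibility up to a
    nonzero factor from [{poly F}]. *)
Definition divides (R : comNzRingType) (a b : R) := exists e, b = a * e.

(** * Derivatives and antiderivatives in characteristic [p] *)

Section Primitive.
Variables (R : idomainType) (p : nat) (inv : nat -> R).
Hypotheses (p_char : p \in [pchar R])
  (invP : forall n, ~~ (p %| n)%N -> inv n * n%:R = 1).
Implicit Types e : {poly R}.

Lemma derivn_pchar e : e^`(p) = 0.
Proof.
apply/polyP => i; rewrite coef_derivn coef0 -mulr_natr -bin_ffact natrM.
have -> : p`!%:R = 0 :> R.
  apply/eqP; rewrite -(dvdn_pcharf p_char) dvdn_fact //.
  by rewrite leqnn prime_gt0 // (pcharf_prime p_char).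
by rewrite !mulr0.
Qed.

(** Modulo [p] the factors are [-1], ..., [-m], none of which vanishes. *)
Lemma ffact_pred_ndvd k m : (m < p)%N -> (p %| k.+1)%N -> ~~ (p %| k ^_ m)%N.
Proof.
have p_pr := pcharf_prime p_char.
move=> + pk; elim: m => [|m IH] lt.
  by rewrite ffactn0 dvdn1 neq_ltn prime_gt1 ?orbT.
rewrite ffactnSr Euclid_dvdM // negb_or IH 1?ltnW //=.
have le : (m.+1 <= k.+1)%N by apply: leq_trans (ltnW lt) (dvdn_leq _ pk).
rewrite -subSS dvdn_subr //.
by apply/negP => /(dvdn_leq (ltn0Sn _)); rewrite leqNgt lt.
Qed.

(** The termwise antiderivative. Where [p] divides [k] the value of [inv] is arbitrary, as the
    derivative kills that term. An abstract [inv] serves coefficients in [F] as well as in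
    [{poly F}]. *)
Definition prim e := \poly_(k < (size e).+1) (e`_k.-1 * inv k).

Lemma prim0 : prim 0 = 0.
Proof.
apply/polyP => i; rewrite coef_poly !coef0 size_poly0.
by rewrite mul0r if_same.
Qed.

(** The hypothesis says that no exponent of [e] is [-1] modulo [p]; these are the only monomials
    without an antiderivative. *)
Lemma primK e : e^`(p.-1) = 0 -> (prim e)^`() = e.
Proof.
move=> e0; have p_gt0 := prime_gt0 (pcharf_prime p_char).
apply/polyP => k; rewrite coef_deriv coef_poly ltnS /=.
have [lt|le] := ltnP; last by rewrite mul0rn nth_default.
have [pk|npk] := boolP (p %| k.+1)%N; last by rewrite -mulr_natr -mulrA invP // mulr1.
have /eqP := congr1 (fun f : {poly R} => f`_(k - p.-1)) e0.
have le : (p.-1 <= k)%N by rewrite -ltnS prednK // dvdn_leq.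
rewrite coef_derivn subnKC // coef0 -mulr_natr mulf_eq0 -(dvdn_pcharf p_char).
rewrite (negPf (ffact_pred_ndvd _ pk)) ?prednK // orbF => /eqP ->.
by rewrite mul0r mul0rn.
Qed.

Lemma deriv_eq0_comp e : e^`() = 0 ->
  e = (\poly_(k < size e) e`_(k * p)) \Po 'X^p.
Proof.
move=> e0; have p_gt0 := prime_gt0 (pcharf_prime p_char).
apply/polyP => i; rewrite coef_comp_poly_Xn // coef_poly.
case: ifP => [/dvdnP[k ->]|/negbT npi].
  rewrite mulnK //; case: ltnP => // le; rewrite nth_default //.
  by apply: leq_trans le _; rewrite leq_pmulr.
case: i npi => [|i npi]; first by rewrite dvdn0.
have /eqP := congr1 (fun f : {poly R} => f`_i) e0.
by rewrite coef_deriv coef0 -mulr_natr mulf_eq0 -(dvdn_pcharf p_char) (negPf npi) orbF => /eqP.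
Qed.

Lemma deriv_comp_Xp e : (e \Po 'X^p)^`() = 0.
Proof. by rewrite deriv_comp derivXn -mulr_natr -polyC_natr (pcharf0 p_char) polyC0 !mulr0. Qed.

End Primitive.

(** * The subring [F[x^p, T^p]] of [F[x][T]] *)

Section CharP.
Variables (F : fieldType) (p : nat).
Hypothesis p_char : p \in [pchar F].
Implicit Types (a b c e z : {poly {poly F}}) (f g : {poly F}).

Let p_gt0 : (0 < p)%N. Proof. exact: prime_gt0 (pcharf_prime p_char). Qed.

Lemma pchar_polyF : p \in [pchar {poly F}].
Proof.
by rewrite inE (pcharf_prime p_char) -polyC_natr (pcharf0 p_char) polyC0 /=.
Qed.

Let invF (n : nat) : F := n%:R^-1.
Let invFP n : ~~ (p %| n)%N -> invF n * n%:R = 1.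
Proof. by rewrite (dvdn_pcharf p_char) => n0; rewrite mulVf. Qed.
Let invP n : ~~ (p %| n)%N -> (invF n)%:P * n%:R = 1 :> {poly F}.
Proof. by move=> n0; rewrite -polyC_natr -polyCM invFP. Qed.

(** The embedding of [F[s][t]] into [B] with [s |-> x^p] and [t |-> T^p]; followed by [phi] it is
    [zeval]. *)
Definition zemb z := map_poly (comp_poly 'X^p) z \Po 'X^p.

Lemma coef_zemb z i :
  (zemb z)`_i = if (p %| i)%N then z`_(i %/ p) \Po 'X^p else 0.
Proof. by rewrite coef_comp_poly_Xn // coef_map. Qed.

Lemma zembM a b : zemb (a * b) = zemb a * zemb b.
Proof. by rewrite /zemb !rmorphM. Qed.
Lemma zemb0 : zemb 0 = 0.
Proof. by rewrite /zemb !rmorph0. Qed.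
Lemma zemb1 : zemb 1 = 1.
Proof. by rewrite /zemb !rmorph1. Qed.
Lemma zembC f : zemb f%:P = (f \Po 'X^p)%:P.
Proof. by rewrite /zemb map_polyC comp_polyC. Qed.

Lemma comp_Xp_inj : injective (fun f => f \Po 'X^p).
Proof.
move=> f g e; apply/polyP => i; have := congr1 (fun f : {poly F} => f`_(i * p)) e.
by rewrite !coef_comp_poly_Xn // dvdn_mull // mulnK.
Qed.

Lemma zemb_inj : injective zemb.
Proof.
move=> a b e; apply/polyP => i; apply: comp_Xp_inj.
have := congr1 (fun f : {poly {poly F}} => f`_(i * p)) e.
by rewrite !coef_zemb dvdn_mull // mulnK.
Qed.

(** A condition in [B]: it describes [F[x^p, T^p]], whose image under [phi] is central for the Weyl
    product. *)
Definition central c := c^`() = 0 /\ dx c = 0.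

Lemma zemb_central z : central (zemb z).
Proof.
split; first exact: deriv_comp_Xp pchar_polyF _.
apply/polyP => i; rewrite coef_dx coef_zemb coef0.
by case: ifP; rewrite ?deriv0 // (deriv_comp_Xp p_char).
Qed.

Lemma centralP c : central c -> exists z, c = zemb z.
Proof.
case=> c0 d0; exists (\poly_(k < size c)
  \poly_(l < size (c`_(k * p))) (c`_(k * p))`_(l * p)).
rewrite [LHS](deriv_eq0_comp pchar_polyF c0) /zemb; congr (_ \Po _).
apply/polyP => k; rewrite coef_map /= !coef_poly; case: ifP => _; last by rewrite comp_poly0.
apply: (deriv_eq0_comp p_char).
by rewrite -coef_dx d0 coef0.
Qed.

Lemma central_divr c e : central c -> c != 0 -> central (c * e) -> central e.
Proof.
move=> [c0 d0] cn0 []; rewrite derivM dxM c0 d0 !mul0r !add0r.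
by move=> /eqP + /eqP; rewrite !mulf_eq0 (negPf cn0) => /eqP ? /eqP ?.
Qed.

(** Replace [b] by [k * d b] until [d b] falls into [D]; each replacement lowers the number of
    applications of [d] that give [0]. The factor [k] appears because [Q] is only stable under
    [k * d]. *)
Lemma descend (d : {poly {poly F}} -> {poly {poly F}}) (k : {poly {poly F}})
    (Q D : {poly {poly F}} -> Prop) n b :
  (forall b, d (k * b) = k * d b) -> (forall b, Q b -> Q (k * d b)) ->
  D 0 -> (forall b, D (k * b) -> D b) ->
  iter n d b = 0 -> Q b -> ~ D b -> exists c, [/\ Q c, ~ D c & D (d c)].
Proof.
move=> dk Qd D0 Dk; elim: n b => [|n IH] b.
  by move=> /= -> _ /(_ D0).
have [? _ ? ?|nDd] := classic (D (d b)); first by exists b.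
rewrite iterSr => itb Qb nDb; apply: (IH (k * d b)); last 2 first.
- exact: Qd.
- by move/Dk.
have -> : iter n d (k * d b) = k * iter n d (d b).
  by elim: n {IH itb} => //= n ->; rewrite dk.
by rewrite itb mulr0.
Qed.

(* The antiderivative trick: if [z] is central and [d b = z e], then the [(p-1)]-st derivative of [e]
   vanishes, so [e = d E] and [b - z E] is a constant of [d]. *)
Lemma central_reduction z k (Q : {poly {poly F}} -> Prop) b :
  central z -> central k ->
  (forall b, Q b -> Q (k * b^`())) ->
  (forall b, Q b -> b^`() = 0 -> Q (k * dx b)) ->
  (forall b e, Q b -> Q (b - z * e)) ->
  (forall b, divides z (k * b) -> divides z b) ->
  Q b -> ~ divides z b -> exists c, [/\ central c, Q c & ~ divides z c].
Proof.
move=> [z0 dz0] [k0 dk0] Qd Qdx Qz Dk Qb nDb.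
have D0 : divides z 0 by exists 0; rewrite mulr0.
have dsub e b' : ~ divides z b' -> ~ divides z (b' - z * e).
  by move=> n [e' he]; apply: n; exists (e + e'); rewrite mulrDr -he addrC subrK.
have derz n e : (z * e)^`(n) = z * e^`(n).
  by elim: n => // n IH; rewrite derivnS IH derivM z0 mul0r add0r.
have dxz n e : iter n (@dx F) (z * e) = z * iter n (@dx F) e.
  by elim: n => //= n ->; rewrite dxM dz0 mul0r add0r.
(* First pass: the derivative in [T]. *)
have [|b1 [Qb1 nDb1 [e1 he1]]] := @descend (@deriv _) k Q (divides z) p b _ Qd D0 Dk
    (derivn_pchar pchar_polyF b) Qb nDb.
  by move=> v; rewrite derivM k0 mul0r add0r.
have [E1 hE1] : exists E, b1^`() = (z * E)^`().
  have [zz|zn0] := eqVneq z 0; first by exists 0; rewrite he1 zz !mul0r deriv0.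
  have e10 : e1^`(p.-1) = 0.
    have /eqP := derivn_pchar pchar_polyF b1.
    rewrite -(prednK p_gt0) derivSn he1 derz mulf_eq0 (negPf zn0) /= => /eqP e.
    exact: e.
  exists (prim (fun n => (invF n)%:P) e1).
  by rewrite derivM z0 mul0r add0r (primK pchar_polyF invP).
pose b2 := b1 - z * E1.
have b2d : b2^`() = 0 by rewrite derivB hE1 subrr.
(* Second pass: the derivative in [x], while [Q2] keeps the derivative in [T] equal to zero. *)
pose Q2 b := Q b /\ b^`() = 0.
have [|||b3 [[Qb3 b3d] nDb3 [e3 he3]]] :=
    @descend (@dx F) k Q2 (divides z) p b2 _ _ D0 Dk _ (conj (Qz _ _ Qb1) b2d) (dsub _ _ nDb1).
- by move=> v; rewrite dxM dk0 mul0r add0r.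
- move=> v [Qv v0]; split; first exact: Qdx.
  by rewrite derivM k0 mul0r add0r deriv_dx v0 dx0 mulr0.
- by apply/polyP => i; rewrite coef_iter_dx coef0 derivn_pchar.
have [E3 [hE3 E3d]] : exists E, dx b3 = dx (z * E) /\ (z * E)^`() = 0.
  have [zz|zn0] := eqVneq z 0.
    by exists 0; rewrite he3 zz !mul0r dx0 deriv0.
  have e3d : e3^`() = 0.
    apply/eqP; have /eqP := congr1 deriv he3.
    by rewrite deriv_dx b3d dx0 derivM z0 mul0r add0r eq_sym mulf_eq0 (negPf zn0).
  have e30 : iter p.-1 (@dx F) e3 = 0.
    apply/eqP; have : iter p (@dx F) b3 == 0.
      by apply/eqP/polyP => i; rewrite coef_iter_dx coef0 derivn_pchar.
    by rewrite -(prednK p_gt0) iterSr he3 dxz mulf_eq0 (negPf zn0).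
  have pz := prim0 invF.
  pose E := map_poly (prim invF) e3; exists E; split.
    rewrite dxM dz0 mul0r add0r he3; congr (_ * _); apply/polyP => i.
    rewrite coef_dx coef_map_id0 // (primK p_char invFP) //.
    by rewrite -coef_iter_dx e30 coef0.
  (* [prim] acts on each coefficient and fixes [0], so [E] involves no power of [T] that is absent
     from [e3]. *)
  rewrite derivM z0 mul0r add0r; suff -> : E^`() = 0 by rewrite mulr0.
  apply/polyP => i; rewrite coef_deriv coef0 coef_map_id0 //.
  have /eqP := congr1 (fun v : {poly {poly F}} => v`_i) e3d.
  rewrite coef_deriv coef0 -mulr_natr mulf_eq0 => /orP[/eqP ->|/eqP n0].
    by rewrite pz mul0rn.
  by rewrite -mulr_natr n0 mulr0.
exists (b3 - z * E3); split; [split| exact: Qz | exact: dsub].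
  by rewrite derivB b3d E3d subrr.
by rewrite dxB hE3 subrr.
Qed.

(* A consequence of the freeness of [F[x, T]] over [F[x^p, T^p]]. *)
Lemma zemb_prime z c b : z != 0 ->
  (forall a b, divides z (a * b) -> divides z a \/ divides z b) ->
  divides (zemb z) (zemb c * b) -> divides z c \/ divides (zemb z) b.
Proof.
move=> zn0 prz Db; have [|nDb] := classic (divides (zemb z) b); [by right | left].
have [c0 dc0] := zemb_central c; have [z0 dz0] := zemb_central z.
(* The [v] with [zemb c * v] divisible by [zemb z] are stable under both derivations, so [k = 1] is
   allowed. *)
have [|||||c1 [/centralP[c2 ->] [e he] nDc1]] :=
  @central_reduction (zemb z) 1 (fun b => divides (zemb z) (zemb c * b)) b
    (zemb_central z) _ _ _ _ _ Db nDb.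
- by rewrite -zemb1; apply: zemb_central.
- move=> v [e /(congr1 deriv)]; rewrite mul1r !derivM c0 z0 !mul0r !add0r => ->.
  by exists e^`().
- move=> v [e he] _; have := congr1 (@dx F) he; rewrite mul1r !dxM dc0 dz0 !mul0r !add0r => ->.
  by exists (dx e).
- by move=> v e [e' he]; exists (e' - zemb c * e); rewrite !mulrBr he mulrCA.
- by move=> v; rewrite mul1r.
have izn0 : zemb z != 0 by rewrite -zemb0 (inj_eq zemb_inj).
have /centralP[e' e'P] : central e.
  by apply: (central_divr (zemb_central z) izn0); rewrite -he -zembM; apply: zemb_central.
have [//|[e2 he2]] : divides z c \/ divides z c2.
  by apply: prz; exists e'; apply: zemb_inj; rewrite !zembM he e'P.
by case: nDc1; exists (zemb e2); rewrite he2 zembM.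
Qed.

End CharP.

(** * Irreducible elements of [F[s][t]] are prime *)

(** Induction on [mu]: a reducible [z] splits into two factors of smaller [mu], one of which still
    satisfies [S]. *)
Lemma irreducible_in (R : idomainType) (mu : R -> nat) (S : R -> Prop) :
  (forall a b, a != 0 -> b != 0 -> mu (a * b) = (mu a + mu b)%N) ->
  (forall a, a != 0 -> mu a = 0%N -> a \is a GRing.unit) ->
  (forall a, S a -> a \isn't a GRing.unit) ->
  (forall a b, a \isn't a GRing.unit -> b \isn't a GRing.unit ->
     S (a * b) -> S a \/ S b) ->
  forall z, z != 0 -> S z -> exists z', irreducible_elt z' /\ S z'.
Proof.
move=> muM mu0 SN SM z; have [n] := ubnP (mu z); elim: n z => // n IH z lt zn0 Sz.
have [irr|nirr] := classic (irreducible_elt z); first by exists z.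
have [a [b [z_eq aN bN]]] : exists a b, [/\ z = a * b, a \isn't a GRing.unit &
    b \isn't a GRing.unit].
  apply: NNPP => none; apply: nirr; split=> //; first exact: SN.
  move=> a b z_eq; apply: NNPP => nU; apply: none; exists a, b; split=> //.
    by apply/negP => U; apply: nU; left.
  by apply/negP => U; apply: nU; right.
have an0 : a != 0 by apply: contraNneq zn0 => e; rewrite z_eq e mul0r.
have bn0 : b != 0 by apply: contraNneq zn0 => e; rewrite z_eq e mulr0.
have mua : (0 < mu a)%N by rewrite lt0n; apply: contraNneq aN; apply: mu0.
have mub : (0 < mu b)%N by rewrite lt0n; apply: contraNneq bN; apply: mu0.
move: lt; rewrite z_eq muM // ltnS => lt.
rewrite z_eq in Sz; case: (SM _ _ aN bN Sz) => [Sa|Sb].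
  by apply: (IH a) => //; apply: leq_trans lt; rewrite -[X in (X < _)%N]addn0 ltn_add2l.
by apply: (IH b) => //; apply: leq_trans lt; rewrite -[X in (X < _)%N]add0n ltn_add2r.
Qed.

Section Gauss.
Variable F : fieldType.
Implicit Types (a b c e z q g : {poly {poly F}}) (f : {poly F}).

(** Additive because leading coefficients multiply; on nonzero elements it vanishes only at
    units. *)
Definition bidegree z := ((size z).-1 + (size (lead_coef z)).-1)%N.

Lemma size_pred_mul (R : idomainType) (a b : {poly R}) : a != 0 -> b != 0 ->
  (size (a * b)).-1 = ((size a).-1 + (size b).-1)%N.
Proof.
move=> an0 bn0; rewrite size_mul // -(prednK (_ : 0 < size a)%N) ?size_poly_gt0 //.
by rewrite -(prednK (_ : 0 < size b)%N) ?size_poly_gt0 // addnS.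
Qed.

Lemma bidegreeM a b : a != 0 -> b != 0 ->
  bidegree (a * b) = (bidegree a + bidegree b)%N.
Proof.
move=> an0 bn0; rewrite /bidegree lead_coefM !size_pred_mul ?lead_coef_eq0 //.
by rewrite addnACA.
Qed.

Lemma size_pred0_unit f : f != 0 -> (size f).-1 = 0%N -> f \is a GRing.unit.
Proof.
move=> fn0 /eqP; rewrite -subn1 subn_eq0 => s1.
have /eqP s : size f == 1%N by rewrite eqn_leq s1 size_poly_gt0.
rewrite poly_unitE s eqxx /= unitfE.
by rewrite -[0%N]/(1.-1)%N -s -lead_coefE lead_coef_eq0.
Qed.

Lemma polyC_unit f : (f%:P \is a GRing.unit) = (f \is a GRing.unit).
Proof.
rewrite poly_unitE coefC eqxx size_polyC.
by have [->|] := eqVneq f 0; rewrite ?unitr0.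
Qed.

Lemma bidegree0_unit z : z != 0 -> bidegree z = 0%N -> z \is a GRing.unit.
Proof.
move=> zn0 /eqP; rewrite addn_eq0 => /andP[/eqP s /eqP l].
have /size1_polyC z_eq : (size z <= 1)%N by rewrite -subn_eq0 subn1 s.
have l_eq : lead_coef z = z`_0 by rewrite lead_coefE s.
rewrite z_eq polyC_unit -l_eq; apply: size_pred0_unit => //.
by rewrite lead_coef_eq0.
Qed.

Lemma unit_polyC f : f \is a GRing.unit -> exists2 c, c != 0 & f = c%:P.
Proof.
rewrite poly_unitE => /andP[/eqP s]; rewrite unitfE => c; exists f`_0 => //.
by apply: size1_polyC; rewrite s.
Qed.

Lemma irreducible_elt_poly f : irreducible_elt f -> irreducible_poly f.
Proof.
move=> [fn0 fN irr]; split.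
  rewrite ltnNge; apply: contra fN => s; apply: size_pred0_unit => //.
  by apply/eqP; rewrite -subn1 subn_eq0.
move=> d sd /dvdpP[k f_eq]; case: (irr _ _ f_eq) => [/unit_polyC[c cn0 k_eq]|].
  by rewrite f_eq k_eq mul_polyC eqp_sym eqp_scale.
by case/unit_polyC => c cn0 d_eq; move: sd; rewrite d_eq size_polyC cn0.
Qed.

Lemma irreducible_divisor f : f != 0 -> f \isn't a GRing.unit ->
  exists f', irreducible_poly f' /\ f' %| f.
Proof.
move=> fn0 fN; pose S (g : {poly F}) := g \isn't a GRing.unit /\ g %| f.
have [|||||g [/irreducible_elt_poly irr [_ gf]]] :=
  @irreducible_in _ (fun g : {poly F} => (size g).-1) S _ _ _ _ f fn0 _.
- exact: size_pred_mul.
- exact: size_pred0_unit.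
- by move=> a [].
- move=> a b aN bN [_ abf]; left; split=> //.
  by apply: dvdp_trans abf; apply: dvdp_mulr.
- by split.
by exists g.
Qed.

Lemma dividesC f b : divides f%:P b <-> forall i, f %| b`_i.
Proof.
split=> [[e ->] i|/dvd_coef_scale[e ->]]; first by rewrite mul_polyC coefZ dvdp_mulr.
by exists e; rewrite mul_polyC.
Qed.

(** Gauss's lemma: if [i] and [j] are the first indices where [f] fails to divide a coefficient of
    [a] and of [b], it fails at [i + j] for the product. *)
Lemma irreducibleC_prime f a b : irreducible_poly f ->
  divides f%:P (a * b) -> divides f%:P a \/ divides f%:P b.
Proof.
move=> irr /dividesC fab; apply: NNPP => none.
have ex c : ~ divides f%:P c -> exists i, ~~ (f %| c`_i).
  move=> nd; apply: NNPP => ne; apply: nd; apply/dividesC => i.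
  by apply/negPn/negP => ni; apply: ne; exists i.
have [exa exb] : (exists i, ~~ (f %| a`_i)) /\ (exists i, ~~ (f %| b`_i)).
  by split; apply: ex => d; apply: none; [left | right].
case: (ex_minnP exa) => i nai mini; case: (ex_minnP exb) => j nbj minj.
have lt_ij : (i < (i + j).+1)%N by rewrite ltnS leq_addr.
have := fab (i + j)%N; rewrite coefM (bigD1 (Ordinal lt_ij)) //= addKn dvdp_addl.
  by case/(irreducible_dvdM irr); apply/negP.
elim/big_ind: _ => [|x y|k]; [exact: dvdp0 | exact: dvdp_add |].
rewrite -val_eqE /= neq_ltn => /orP[lt|lt].
  by rewrite dvdp_mulr //; apply/negPn/negP => /mini; rewrite leqNgt lt.
rewrite dvdp_mull //; apply/negPn/negP => /minj; rewrite leqNgt.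
by rewrite ltn_subLR ?ltn_add2r ?lt // -ltnS.
Qed.

(** The irreducible factors of [f] stay prime by Gauss's lemma, so they are cancelled one at a time
    against [q] or [g]. *)
Lemma strip_constant f b q g : f != 0 -> f%:P * b = q * g ->
  exists f1 f2 q1 g1, [/\ b = q1 * g1, q = f1%:P * q1 & g = f2%:P * g1].
Proof.
have [n] := ubnP (size f); elim: n f q g => // n IH f q g lt fn0 fb.
have [/unit_polyC[c cn0 f_eq]|fN] := boolP (f \is a GRing.unit).
  exists f, 1, (c^-1%:P%:P * q), g; split; last by rewrite mul1r.
    by rewrite -mulrA -fb f_eq mulrA -!polyCM mulVf // mul1r.
  by rewrite f_eq mulrA -!polyCM mulfV // mul1r.
have [r [irr /dvdpP[f' f_eq]]] := irreducible_divisor fn0 fN.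
have rn0 := irredp_neq0 irr.
have f'n0 : f' != 0 by apply: contraNneq fn0 => e; rewrite f_eq e mul0r.
have sf' : (size f' < n)%N.
  have [s _] := irr; move: lt; rewrite ltnS f_eq size_mul //.
  by apply: leq_trans; case: (size r) s => // -[|m] // _; rewrite !addnS /= ltnS leq_addr.
have rP : r%:P != 0 :> {poly {poly F}} by rewrite polyC_eq0.
have [|[q' q_eq]|[g' g_eq]] := @irreducibleC_prime r q g irr.
- by exists (f'%:P * b); rewrite -fb f_eq polyCM mulrAC mulrC.
- have [|f1 [f2 [q1 [g1 [-> q'_eq ->]]]]] := IH f' q' g sf' f'n0.
    by apply: (mulfI rP); rewrite [RHS]mulrA -q_eq -fb f_eq mulrA -polyCM [r * _]mulrC.
  by exists (r * f1), f2, q1, g1; split=> //; rewrite q_eq q'_eq polyCM mulrA.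
- have [|f1 [f2 [q1 [g1 [-> -> g'_eq]]]]] := IH f' q g' sf' f'n0.
    by apply: (mulfI rP); rewrite [RHS]mulrCA -g_eq -fb f_eq mulrA -polyCM [r * _]mulrC.
  by exists f1, (r * f2), q1, g1; split=> //; rewrite g_eq g'_eq polyCM mulrA.
Qed.

Lemma unit_dividesl a b c : a \is a GRing.unit -> b = a * c -> divides b c.
Proof. by move=> aU ->; exists a^-1; rewrite mulrAC divrr ?mul1r. Qed.

(* Pseudo-division over [{poly F}] plays the role of divisibility over its fraction field. *)
Lemma pseudo_divides z b : irreducible_elt z -> (1 < size z)%N ->
  z %| b -> divides z b.
Proof.
move=> [zn0 zN irr] sz /Pdiv.Idomain.dvdpP[[c k] /= cn0].
rewrite -mul_polyC => /(strip_constant cn0)[f1 [f2 [q1 [g1 [-> _ z_eq]]]]].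
case: (irr _ _ z_eq) => U.
  have [e ->] := unit_dividesl U z_eq.
  by exists (q1 * e); rewrite mulrCA.
move: sz; rewrite z_eq mul_polyC ltnNge => /negP[].
apply: leq_trans (size_scale_leq _ _) _.
by move: U; rewrite poly_unitE => /andP[/eqP ->].
Qed.

(** The conclusion is irreducibility over the fraction field [F(s)]: clearing denominators turns a
    divisor over [F(s)] into a factor of [z]. *)
Lemma irreducible_elt_pseudo z : irreducible_elt z -> (1 < size z)%N -> irreducible_poly z.
Proof.
move=> [zn0 zN irr] sz; split=> // q sq /Pdiv.Idomain.dvdpP[[c k] /= cn0].
rewrite -mul_polyC => czk.
have qn0 : q != 0.
  apply/eqP => q0; move/eqP: czk.
  by rewrite q0 mulr0 mulf_eq0 polyC_eq0 (negPf cn0) (negPf zn0).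
have [f1 [f2 [q1 [g1 [z_eq _ q_eq]]]]] := strip_constant cn0 czk.
have f2n0 : f2 != 0 by apply: contraNneq qn0 => e; rewrite q_eq e mul0r.
case: (irr _ _ z_eq) => U; last first.
  by move: U sq; rewrite poly_unitE q_eq mul_polyC size_scale // => /andP[->].
move: U; rewrite poly_unitE => /andP[/eqP s U].
have q1_eq : q1 = (q1`_0)%:P by apply: size1_polyC; rewrite s.
apply/eqpP; exists (q1`_0, f2) => /=.
  by rewrite f2n0 andbT; apply: contraTneq U => ->; rewrite unitr0.
by rewrite z_eq {2}q1_eq q_eq -!mul_polyC mulrCA.
Qed.

(** For [z] in [F[s]] this is Gauss's lemma; otherwise Euclid's lemma holds over [F(s)], and
    [pseudo_divides] brings divisibility back to [F[s][t]]. *)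
Lemma irreducible_elt_prime z a b : irreducible_elt z ->
  divides z (a * b) -> divides z a \/ divides z b.
Proof.
move=> irr; have [/size1_polyC z_eq|sz] := leqP (size z) 1.
  move: (z`_0) z_eq irr => f -> [z0 zN irr].
  apply: irreducibleC_prime; apply: irreducible_elt_poly; split.
  - by rewrite -polyC_eq0.
  - by rewrite -polyC_unit.
  - by move=> f1 f2 e; rewrite -!polyC_unit; apply: irr; rewrite e polyCM.
case=> e ab_eq; have zab : z %| a * b by rewrite ab_eq; apply: dvdp_mulr.
have [/(pseudo_divides irr sz)|nza] := boolP (z %| a); [by left | right].
apply: pseudo_divides => //; move: zab; rewrite Gauss_dvdpr //.
by rewrite irreducible_poly_coprime //; apply: irreducible_elt_pseudo.
Qed.

End Gauss.

(** * Height one primes in characteristic [p] *)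

Section RamifiedFactor.
Variables (F : fieldType) (p : nat).
Hypothesis p_char : p \in [pchar F].
Implicit Types (z : {poly {poly F}}) (f g q u v : {poly F}).

Let p_gt0 : (0 < p)%N. Proof. exact: prime_gt0 (pcharf_prime p_char). Qed.

Lemma deriv_pow_pchar f : (f ^+ p)^`() = 0.
Proof.
rewrite deriv_exp -mulr_natr -polyC_natr.
by rewrite (pcharf0 p_char) polyC0 mulr0.
Qed.

(** These [f] form an ideal of [F[s]]; Euclidean descent from the nonzero member [v] finds a
    generator. *)
Lemma comp_dvd_principal u v : v != 0 -> u %| v \Po 'X^p ->
  exists q, [/\ q != 0, u %| q \Po 'X^p & forall f, u %| f \Po 'X^p -> q %| f].
Proof.
have [n] := ubnP (size v); elim: n v => // n IH v lt vn0 uv.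
have [all|/not_all_ex_not[f nf]] := classic (forall f, u %| f \Po 'X^p -> v %| f).
  by exists v.
have [uf nvf] := imply_to_and _ _ nf.
apply: (IH (f %% v)).
- by rewrite -ltnS; apply: leq_trans lt; rewrite ltnS ltn_modp.
- by apply/negP => e; apply: nvf.
- have -> : f %% v = f - f %/ v * v by rewrite {2}(divp_eq f v) addrAC subrr add0r.
  by rewrite comp_polyB comp_polyM dvdp_sub // dvdp_mull.
Qed.

(** If [q(x^p) = g u^k] with [0 < k < p], the vanishing derivative shows that [u] divides [k g u'].
    As [u] is prime to [u'], it divides [g]. *)
Lemma pow_dvd_comp u q k : irreducible_poly u -> u^`() != 0 ->
  u %| q \Po 'X^p -> (0 < k <= p)%N -> u ^+ k %| q \Po 'X^p.
Proof.
move=> irr u'n0 uq; elim: k => // -[_ _|k IH] /=; first by rewrite expr1.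
move=> kp; have /IH/dvdpP[g q_eq] : (0 < k.+1 <= p)%N by rewrite /= ltnW.
rewrite q_eq exprS dvdp_mul // -dvdpNr.
have un0 := irredp_neq0 irr.
have kn0 : k.+1%:R != 0 :> F.
  by rewrite -(dvdn_pcharf p_char); apply/negP => /(dvdn_leq (ltn0Sn _)); rewrite leqNgt kp.
have cop : coprimep u u^`().
  by rewrite irreducible_poly_coprime // gtNdvdp // lt_size_deriv.
have e : (g^`() * u + g * u^`() * k.+1%:R) * u ^+ k = 0.
  rewrite -(deriv_comp_Xp p_char q) q_eq derivM deriv_exp /= exprS -[in RHS]mulr_natr.
  by move: (u ^+ k) (k.+1%:R) g^`() u^`() => uk m g' u'; ring.
move/eqP: e; rewrite mulf_eq0 expf_eq0 (negPf un0) andbF orbF addr_eq0 => /eqP e.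
have : u %| g * u^`() * k.+1%:R.
  by rewrite -dvdpNr -e dvdp_mull.
by rewrite -polyC_natr mulrC mul_polyC dvdpZr // Gauss_dvdpl // dvdpNr.
Qed.

(* The second case is the generic one; the first occurs when [u] itself is a polynomial in [x^p]. *)
Lemma irreducible_over_factor z u : irreducible_elt z -> irreducible_poly u ->
  divides u%:P (zemb p z) ->
  exists2 xi, xi != 0 & zemb p z = (xi *: u)%:P \/ zemb p z = (xi *: u ^+ p)%:P.
Proof.
move=> irrz irr /dividesC uz.
have un0 := irredp_neq0 irr.
(* [u^p] is a polynomial [v] in [x^p]; this is the member from which the generator [q] is found. *)
have up_eq := deriv_eq0_comp p_char (deriv_pow_pchar u).
set v := (\poly_(k < _) _) in up_eq.
have vn0 : v != 0.
  have : u ^+ p != 0 by rewrite expf_neq0.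
  by apply: contraNneq => v0; rewrite up_eq v0 comp_poly0.
have [q [qn0 uq qmin]] : exists q, [/\ q != 0, u %| q \Po 'X^p &
    forall f, u %| f \Po 'X^p -> q %| f].
  by apply: (@comp_dvd_principal u v) => //; rewrite -up_eq -(prednK p_gt0) exprS dvdp_mulr.
have qN : q \isn't a GRing.unit.
  apply/negP => /unit_polyC[c cn0 q_eq]; move: uq; rewrite q_eq comp_polyC.
  by apply/negP; rewrite -[c%:P]mulr1 mul_polyC dvdpZr // irreducible_dvd1.
(* The coefficients of [zemb p z] at multiples of [p] are those of [z] evaluated at [x^p], so [q]
   divides them all. Irreducibility then makes the cofactor [e] a constant. *)
have [e z_eq] : divides q%:P z.
  apply/dividesC => j; apply: qmin; have := uz (j * p)%N.
  by rewrite coef_zemb // dvdn_mull // mulnK.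
have [zn0 zN irr'] := irrz.
case: (irr' _ _ z_eq); first by rewrite polyC_unit (negPf qN).
rewrite poly_unitE => /andP[/eqP s /unit_polyC[c cn0 e0_eq]].
have e_eq : e = c%:P%:P by rewrite -e0_eq; apply: size1_polyC; rewrite s.
have iz_eq : zemb p z = (c *: (q \Po 'X^p))%:P.
  by rewrite z_eq e_eq zembM !zembC comp_polyC -polyCM mulrC mul_polyC.
have fin w : q \Po 'X^p %= w -> exists2 xi, xi != 0 & zemb p z = (xi *: w)%:P.
  case/eqpP => -[c1 c2] /= /andP[c1n0 c2n0] qw; exists (c * (c1^-1 * c2)).
    by rewrite !mulf_neq0 // invr_eq0.
  by rewrite iz_eq -!scalerA -qw [c1^-1 *: _]scalerA mulVf ?scale1r.
have [u'0|u'n0] := eqVneq u^`() 0.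
  have [|xi xin0 e1] := fin u; last by exists xi => //; left.
  have u_eq := deriv_eq0_comp p_char u'0; set w := (\poly_(k < _) _) in u_eq.
  rewrite /eqp uq andbT [X in _ %| X]u_eq; apply: dvdp_comp_poly; apply: qmin.
  by rewrite -u_eq.
have [|xi xin0 e1] := fin (u ^+ p); last by exists xi => //; right.
rewrite /eqp pow_dvd_comp ?p_gt0 ?leqnn // andbT up_eq; apply: dvdp_comp_poly.
by apply: qmin; rewrite -up_eq -(prednK p_gt0) exprS dvdp_mulr.
Qed.

End RamifiedFactor.

(** * Ideals of [A_h] and its centre in characteristic [p] *)

Section WeylCharP.
Variables (F : fieldType) (p : nat) (h : {poly F}).
Hypotheses (p_char : p \in [pchar F]) (h_neq0 : h != 0).
Implicit Types (a b c e w z : {poly {poly F}}) (f g : {poly F}).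

Let p_gt0 : (0 < p)%N. Proof. exact: prime_gt0 (pcharf_prime p_char). Qed.

(** So [y^p] is central: the intermediate binomial coefficients vanish, and so does the [p]-th
    derivative in [x]. *)
Lemma iter_wD_pchar b : iter p (@wD F) b = b * 'X^p.
Proof.
rewrite iter_wDE big_ord_recl /= subn0 bin0 mulr1n mulrC big1 ?addr0 // => k _.
rewrite /bump /= add1n; have [kp|] := ltnP k.+1 p.
  rewrite -mulr_natr -!polyC_natr; suff -> : 'C(p, k.+1)%:R = 0 :> F by rewrite !polyC0 mulr0.
  by apply/eqP; rewrite -(dvdn_pcharf p_char) prime_dvd_bin // (pcharf_prime p_char).
move=> pk; have {pk} k_eq : k.+1 = p by apply/eqP; rewrite eqn_leq pk ltn_ord.
suff e : iter p (@dx F) b = 0 by rewrite -iterS k_eq e mulr0 mul0rn.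
by apply/polyP => i; rewrite coef_iter_dx coef0 derivn_pchar.
Qed.

(** [w] only involves powers of [y^p], which commute with everything. *)
Lemma weyl_mul_constl w b : w^`() = 0 -> weyl_mul w b = w * b.
Proof.
move=> w0; rewrite weyl_mulE_size -[X in _ = X * _]coefK poly_def mulr_suml.
apply: eq_bigr => i _; rewrite -scalerAl.
have := congr1 (fun w : {poly {poly F}} => w`_i) (deriv_eq0_comp (pchar_polyF p_char) w0).
rewrite coef_comp_poly_Xn //; case: ifP => [/dvdnP[k ->] _|_ ->]; last by rewrite !scale0r.
congr (_ *: _); elim: k => [|k IH]; first by rewrite mul0n expr0 mul1r.
by rewrite mulSn iterD IH iter_wD_pchar exprD mulrC mulrA.
Qed.

Lemma dx_phi b : b^`() = 0 -> dx (phi h b) = phi h (dx b).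
Proof.
move=> b0; apply: (@mulfI _ h%:P); rewrite ?polyC_eq0 // !mul_polyC.
by rewrite scale_dx_phi /yhder b0 mulr0 scaler0 addr0 phiZ.
Qed.

Lemma deriv_phi b : (phi h b)^`() = h *: phi h b^`().
Proof. by rewrite /phi deriv_comp derivZ derivX mulrC -scalerAl mul1r. Qed.

Lemma weyl_mul_phi_constl b w : b^`() = 0 -> weyl_mul (phi h b) w = phi h b * w.
Proof. by move=> b0; apply: weyl_mul_constl; rewrite deriv_phi b0 phi0 scaler0. Qed.

Lemma weyl_mul_phi_central c w : central c -> weyl_mul w (phi h c) = w * phi h c.
Proof. by case=> c0 dc0; apply: weyl_mul_constr; rewrite dx_phi // dc0 phi0. Qed.

Lemma weyl_phi_comm c w : central c -> weyl_mul w (phi h c) = weyl_mul (phi h c) w.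
Proof.
by move=> cc; rewrite weyl_mul_phi_central // weyl_mul_phi_constl 1?mulrC //; case: cc.
Qed.

(** [h^p y^p] is the commutative power [(h y)^p], and its Weyl powers are commutative ones because
    its derivative in [y] vanishes. *)
Lemma zevalE z : zeval h p z = phi h (zemb p z).
Proof.
have yX n : weyl_exp (wy F) n = 'X^n.
  rewrite /weyl_exp; elim: n => [|n IH]; first by rewrite expr0.
  by rewrite iterS IH weyl_mulXl /wD dxXn addr0 -exprSr.
pose W : {poly {poly F}} := (h *: 'X) ^+ p.
have We : weyl_mul (h ^+ p)%:P (weyl_exp (wy F) p) = W.
  by rewrite yX weyl_mulCl /W exprZn.
have W0 : W^`() = 0.
  by rewrite /W deriv_exp -mulr_natr -!polyC_natr (pcharf0 p_char) !polyC0 mulr0.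
have expW j : weyl_exp W j = W ^+ j.
  rewrite /weyl_exp; elim: j => [|j IH]; first by rewrite expr0.
  by rewrite iterS IH weyl_mul_constl // exprS.
rewrite /zeval We /phi /zemb -comp_polyA comp_Xn_poly -/W comp_polyE.
rewrite size_map_inj_poly ?comp_poly0 //; last exact: comp_Xp_inj.
by apply: eq_bigr => j _; rewrite weyl_mulCl expW coef_map.
Qed.

Lemma gen_ideal_central c w : central c ->
  gen_ideal h (phi h c) w <-> exists2 b, divides c b & w = phi h b.
Proof.
move=> cc; have [c0 _] := cc; split=> [[a [/in_AhP[b ->] ->]]|[_ [e ->] ->]].
  by exists (c * b); [exists b | rewrite weyl_mul_phi_constl // phiM].
by exists (phi h e); split; [apply: in_Ah_phi | rewrite weyl_mul_phi_constl // phiM].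
Qed.

Lemma gen_ideal_centralP c b : central c ->
  gen_ideal h (phi h c) (phi h b) <-> divides c b.
Proof.
move=> cc; split=> [/(gen_ideal_central _ cc)[b' d /(phi_inj h_neq0) ->] //|d].
by apply/gen_ideal_central => //; exists b.
Qed.

Lemma gen_idealC_divides f b : gen_ideal h f%:P (phi h b) <-> divides f%:P b.
Proof.
split=> [/gen_idealC[e /(phi_inj h_neq0) ->]|[e ->]]; first by exists e; rewrite mul_polyC.
by apply/gen_idealC; exists e; rewrite mul_polyC.
Qed.

Lemma gen_ideal_central_ideal c : central c -> is_ideal h (gen_ideal h (phi h c)).
Proof.
move=> cc; split.
- by move=> w /(gen_ideal_central _ cc)[b _ ->]; apply: in_Ah_phi.
- by rewrite -(phi0 h); apply/gen_ideal_centralP => //; exists 0; rewrite mulr0.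
- move=> a b [a' [ia ->]] [b' [ib ->]]; exists (a' + b'); split; first exact: Ah_add.
  by rewrite weyl_mulDr.
- move=> a r ir [a' [ia ->]]; split.
    exists (weyl_mul r a'); split; first exact: Ah_mul.
    by rewrite !weyl_mulA weyl_phi_comm.
  by exists (weyl_mul a' r); split; [apply: Ah_mul | rewrite weyl_mulA].
Qed.

Lemma central_hp : central (h ^+ p)%:P.
Proof.
split; first exact: derivC.
by rewrite dxC (deriv_pow_pchar p_char) polyC0.
Qed.

(** [central_reduction] for the preimage of [I] in [B]. Commutators with [x] and [y h] give [h]
    times the partial derivatives; a further [h^(p-1)] makes the multiplier [h^p], which is
    central. *)
Lemma ideal_central I c b : is_ideal h I -> central c ->
  (forall e, I (phi h (c * e))) ->
  (forall b, divides c ((h ^+ p)%:P * b) -> divides c b) ->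
  I (phi h b) -> ~ divides c b ->
  exists z, I (phi h (zemb p z)) /\ ~ divides c (zemb p z).
Proof.
move=> idI cc Ic cancel Ib nDb.
have [|||c1 [/(centralP p_char)[z ->] Iz nDz]] :=
  @central_reduction F p p_char c (h ^+ p)%:P (fun b => I (phi h b)) b cc central_hp
    _ _ _ cancel Ib nDb.
- move=> v Iv; have -> : phi h ((h ^+ p)%:P * v^`()) = h ^+ p.-1 *: (phi h v)^`().
    by rewrite mul_polyC phiZ deriv_phi scalerA -exprSr prednK.
  exact: (ideal_scale _ idI (ideal_deriv idI Iv)).
- move=> v Iv v0; have -> : phi h ((h ^+ p)%:P * dx v) = h ^+ p.-1 *: (h *: dx (phi h v)).
    by rewrite mul_polyC phiZ dx_phi // scalerA -exprSr prednK.
  apply: (ideal_scale _ idI); apply: (ideal_dx idI Iv) => f.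
  by rewrite weyl_mul_phi_constl // mulrC mul_polyC.
- by move=> v e Iv; rewrite phiB; apply: (idealB idI).
by exists z.
Qed.

Lemma prime_unit P a : prime_ideal h P -> P (phi h (zemb p a)) -> a \isn't a GRing.unit.
Proof.
move=> [[_ _ _ PM] [w [iw nPw]] _] Pa; apply/negP => aU; apply: nPw.
have [cc _] := zemb_central p_char a.
have : P (weyl_mul (phi h (zemb p a)) (phi h (zemb p a^-1))).
  by have [] := PM _ _ (in_Ah_phi h (zemb p a^-1)) Pa.
rewrite weyl_mul_phi_constl // -phiM -zembM divrr // zemb1 phi1 => P1.
by rewrite -[w]weyl_mul1l; have [] := PM _ _ iw P1.
Qed.

Lemma prime_contains_irreducible P : prime_ideal h P -> (exists w, P w /\ w <> 0) ->
  exists z, irreducible_elt z /\ P (phi h (zemb p z)).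
Proof.
move=> pP [w [Pw wn0]]; have [idP _ Ppr] := pP; have [Pin P0 _ PM] := idP.
have /in_AhP[b w_eq] := Pin _ Pw.
have D0 c : divides 0 c -> c = 0 by case=> e ->; rewrite mul0r.
(* Divisibility by [0] means vanishing, so this yields a nonzero central element of [P]. *)
have [|||||z [Pz nz]] := @ideal_central P 0 b idP.
- by split; rewrite ?deriv0 ?dx0.
- by move=> e; rewrite mul0r phi0.
- move=> c /D0/eqP; rewrite mulf_eq0 polyC_eq0 expf_eq0 (negPf h_neq0) andbF => /eqP ->.
  by exists 0; rewrite mulr0.
- by rewrite -w_eq.
- by move=> /D0 b0; apply: wn0; rewrite w_eq b0 phi0.
apply: (@irreducible_in _ (@bidegree F) (fun z => P (phi h (zemb p z))) _ _ _ _ z) => //.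
- exact: bidegreeM.
- exact: bidegree0_unit.
- by move=> a; apply: prime_unit.
- move=> a c _ _ Pac; apply: Ppr; try exact: in_Ah_phi.
  move=> r ir; have ca := zemb_central p_char a; have [c0 _] := ca.
  rewrite -weyl_phi_comm // -weyl_mulA weyl_mul_phi_constl // -phiM -zembM.
  by have [] := PM _ _ ir Pac.
- by apply/eqP => z0; apply: nz; exists 0; rewrite z0 zemb0 mulr0.
Qed.

(** * Classification in characteristic [p] *)

Section Listed.
Variables (lam : F) (t : nat) (u : 'I_t -> {poly F}) (alpha : 'I_t -> nat).
Hypotheses (u_monic : forall i, u i \is monic)
  (u_irr : forall i, irreducible_poly (u i)) (u_inj : injective u)
  (alpha_gt0 : forall i, (0 < alpha i)%N)
  (h_fact : h = lam%:P * \prod_(i < t) u i ^+ alpha i).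

(** Scalar multiples of [u i] itself remain allowed. They occur when [u i] is a polynomial in [x^p],
    and then both generate the same ideal. *)
Definition unramified z := irreducible_elt z /\
  forall i xi, xi != 0 -> zeval h p z <> (xi *: u i ^+ p)%:P.

Lemma unramified_factor z i : unramified z -> divides (u i)%:P (zemb p z) ->
  exists2 xi, xi != 0 & zemb p z = (xi *: u i)%:P.
Proof.
move=> [irr nr] /(irreducible_over_factor p_char irr (u_irr i))[xi xin0 [e|e]].
  by exists xi.
by case: (nr i xi xin0); rewrite zevalE e phiC.
Qed.

Lemma zemb_scale_divides z f xi b : xi != 0 -> zemb p z = (xi *: f)%:P ->
  divides (zemb p z) b <-> divides f%:P b.
Proof.
move=> xin0 ->; rewrite -mul_polyC polyCM; split=> [[e ->]|[e ->]].
  by exists (xi%:P%:P * e); rewrite mulrA [f%:P * _]mulrC.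
exists (xi^-1%:P%:P * e).
by rewrite mulrACA -!polyCM mulfV // mul1r.
Qed.

Lemma zemb_neq0 z : irreducible_elt z -> zemb p z != 0.
Proof. by case=> zn0 _ _; rewrite -(zemb0 F p) (inj_eq (zemb_inj p_char)). Qed.

Lemma zemb_divides z c : irreducible_elt z ->
  divides (zemb p z) (zemb p c) -> divides z c.
Proof.
move=> irr [e he]; have /(centralP p_char)[e' e'P] : central e.
  apply: (central_divr (zemb_central p_char z) (zemb_neq0 irr)).
  by rewrite -he; apply: zemb_central.
by exists e'; apply: (zemb_inj p_char); rewrite zembM he e'P.
Qed.

(** A divisor of [h^p] has degree [0] in [T], so it is a polynomial in [x]. Being prime to every
    [u i] it is constant, which contradicts irreducibility. *)
Lemma unramified_hp z : irreducible_elt z -> (forall i, ~ divides (u i)%:P (zemb p z)) ->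
  ~ divides (zemb p z) (h ^+ p)%:P.
Proof.
move=> irr nu [e he]; have izn0 := zemb_neq0 irr.
have hpn0 : (h ^+ p)%:P != 0 :> {poly {poly F}} by rewrite polyC_eq0 expf_neq0.
have en0 : e != 0 by apply: contraNneq hpn0 => e0; rewrite he e0 mulr0.
have /size1_polyC : (size (zemb p z) <= 1)%N.
  have := congr1 (fun w : {poly {poly F}} => (size w).-1) he.
  rewrite /= size_polyC expf_neq0 // size_pred_mul // => /esym/eqP.
  by rewrite addn_eq0 => /andP[/eqP s _]; rewrite -subn_eq0 subn1 s.
set f := (_`_0) => f_eq.
have nuf i : ~~ (u i %| f).
  apply/negP => uf; apply: (nu i); rewrite f_eq; apply/dividesC => j.
  by rewrite coefC; case: ifP; rewrite ?dvdp0.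
have fh : f %| h ^+ p.
  have := congr1 (fun w : {poly {poly F}} => w`_0) he.
  by rewrite f_eq mul_polyC coefZ coefC /= => ->; apply: dvdp_mulr.
have /size_poly1P[c cn0 fc] : size f == 1%N.
  move: fh; rewrite -[h ^+ p]mulr1 Gauss_dvdpr ?dvdp1 //.
  by rewrite coprimep_expr // (coprime_factors h_neq0 u_irr h_fact nuf).
have z_eq : z = c%:P%:P.
  by apply: (zemb_inj p_char); rewrite zembC comp_polyC f_eq fc.
by have [_ /negP zN _] := irr; apply: zN;
  rewrite z_eq !polyC_unit poly_unitE size_polyC cn0 coefC unitfE.
Qed.

Lemma unramified_factor_ideal z i : unramified z -> divides (u i)%:P (zemb p z) ->
  gen_ideal h (zeval h p z) = gen_ideal h (u i)%:P.
Proof.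
move=> uz /(unramified_factor uz)[xi xin0 e]; apply: set_eq_eq => w; rewrite zevalE.
split=> [/(gen_ideal_central _ (zemb_central p_char z))[b d ->]|].
  by apply/gen_idealC_divides; apply/(zemb_scale_divides b xin0 e).
case/gen_idealC => b ->; apply/gen_ideal_centralP; first exact: zemb_central.
by apply/(zemb_scale_divides _ xin0 e); exists b; rewrite mul_polyC.
Qed.

Lemma unramified_prime z : unramified z -> prime_ideal h (gen_ideal h (zeval h p z)).
Proof.
move=> uz; have [irr _] := uz; have cz := zemb_central p_char z.
(* If some [u i] divides [z], the ideal is [u i A_h], already known to be prime. *)
have [[i uiz]|nu] := classic (exists i, divides (u i)%:P (zemb p z)).
  rewrite (unramified_factor_ideal uz uiz); apply: domain_prime; apply: factor_domain => //.
  exact: factor_dvd alpha_gt0 h_fact i.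
have {}nu i : ~ divides (u i)%:P (zemb p z) by move=> d; apply: nu; exists i.
have [zn0 zN _] := irr.
have prz c b : divides (zemb p z) (zemb p c * b) ->
    divides (zemb p z) (zemb p c) \/ divides (zemb p z) b.
  move=> d; have [|[e ->]|] := zemb_prime p_char zn0 _ d; last by right.
    by move=> a a'; apply: irreducible_elt_prime.
  by left; exists (zemb p e); rewrite zembM.
rewrite zevalE; have idz := gen_ideal_central_ideal cz; split=> //.
  exists 1; split; first exact: in_Ah1.
  rewrite -(phi1 h) => /gen_ideal_centralP => /(_ cz); rewrite -(zemb1 F p).
  case/(zemb_divides irr) => e he; move/negP: zN; apply.
  by apply/unitrP; exists e; rewrite [e * _]mulrC -he.
move=> a b ia ib ab; have /in_AhP[a' a_eq] := ia; have /in_AhP[b' b_eq] := ib.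
have [|nDa] := classic (gen_ideal h (phi h (zemb p z)) a); [by left | right].
have [_ I0 ID IM] := idz.
(* [J] is a two-sided ideal containing [a] and [z A_h]; reduction gives a central [c] in [J] outside
   [z A_h], and then [c b] lies in [z A_h]. *)
pose J j := in_Ah h j /\
  forall r, in_Ah h r -> gen_ideal h (phi h (zemb p z)) (weyl_mul (weyl_mul j r) b).
have idJ : is_ideal h J.
  split.
  - by move=> w [].
  - by split=> [|r _]; [apply: in_Ah0 | rewrite !weyl_mul0l].
  - move=> v w [iv Jv] [iw Jw]; split; first exact: Ah_add.
    by move=> r ir; rewrite !weyl_mulDl; apply: ID; [apply: Jv | apply: Jw].
  - move=> v r ir [iv Jv]; split; split; try exact: Ah_mul.
      by move=> s ins; rewrite -!weyl_mulA [weyl_mul v _]weyl_mulA;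
        apply: (proj1 (IM _ _ ir _)); apply: Jv.
    by move=> s ins; rewrite -[weyl_mul (weyl_mul v r) s]weyl_mulA; apply: Jv; apply: Ah_mul.
have [||||c [[_ Jc] nDc]] := @ideal_central J (zemb p z) a' idJ cz.
- move=> e; split; first exact: in_Ah_phi.
  move=> r ir; apply: (proj2 (IM _ _ ib _)); apply: (proj2 (IM _ _ ir _)).
  by apply/gen_ideal_centralP => //; exists e.
(* [h^p] comes from the centre and is not divisible by [z], so it can be cancelled modulo [z]. *)
- move=> v; have /(centralP p_char)[H hp] := central_hp.
  rewrite hp => /prz[d|//]; case: (unramified_hp irr nu).
  by rewrite hp.
- by rewrite -a_eq.
- by move=> d; apply: nDa; rewrite a_eq; apply/gen_ideal_centralP.
have := Jc 1 (in_Ah1 h); rewrite weyl_mul1r b_eq.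
rewrite weyl_mul_phi_constl; last by case: (zemb_central p_char c).
rewrite -phiM => /gen_ideal_centralP => /(_ cz)/prz[//|d].
exact/gen_ideal_centralP.
Qed.

Lemma height_one_pchar P : height_one h P <->
  (exists i, set_eq P (gen_ideal h (u i)%:P)) \/
  (exists z, unramified z /\ set_eq P (gen_ideal h (zeval h p z))).
Proof.
pose L Q := (exists i, Q = gen_ideal h (u i)%:P) \/
  (exists z, unramified z /\ Q = gen_ideal h (zeval h p z)).
have [||||f g] := @height_oneP F h h_neq0 L _ _ _ _ P.
- move=> _ [[i ->]|[z [uz ->]]]; last exact: unramified_prime.
  exact: factor_prime h_neq0 u_irr alpha_gt0 h_fact i.
- move=> _ [[i ->]|[z [uz ->]]]; first exact: factor_ideal_neq0.
  exists (zeval h p z); split; first exact: gen_ideal_self.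
  apply/eqP; rewrite zevalE -(phi0 h) (inj_eq (phi_inj h_neq0)) zemb_neq0 //.
  by case: uz.
- move=> Q pQ /(prime_contains_irreducible pQ)[z [irr Qz]].
  (* In the excluded case [z = xi u_i^p], the prime contains [u_i^p], hence [u_i]. *)
  have [[i [xi [xin0 e]]]|nr] :=
      classic (exists i xi, xi != 0 /\ zeval h p z = (xi *: u i ^+ p)%:P).
    exists (gen_ideal h (u i)%:P); split; first by left; exists i.
    apply: gen_ideal_sub => //.
    have [idQ _ _] := pQ.
    have : Q (u i ^+ p)%:P.
      have := ideal_scale xi^-1%:P idQ Qz.
      by rewrite -zevalE e -[xi^-1%:P *: _]mul_polyC -polyCM mul_polyC scalerA mulVf // scale1r.
    rewrite -(prednK p_gt0); elim: (p.-1) => [|n IH]; first by rewrite expr1.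
    rewrite exprS.
    by case/(prime_factor pQ (factor_dvd alpha_gt0 h_fact i)).
  exists (gen_ideal h (zeval h p z)); split; last first.
    by apply: gen_ideal_sub => //; rewrite zevalE.
  right; exists z; split=> //; split=> // i xi xin0 e.
  by apply: nr; exists i, xi.
- move=> _ _ [[i ->]|[z [uz ->]]] [[j ->]|[z' [uz' ->]]] sub.
  + have /(factor_ideal_dvd h_neq0) := sub _ (gen_ideal_self h _).
    by move/(factor_dvd_eq u_monic u_irr u_inj) ->.
  (* If [u i] lies in [z' A_h], then [z'] divides [h^p], so some [u k] divides [z'] and hence [u i].
     Thus [k = i] and the ideals agree. *)
  + have := sub _ (gen_ideal_self h _); rewrite zevalE -(phiC h).
    case/(gen_ideal_centralP _ (zemb_central p_char z')) => e he; rewrite phiC -zevalE.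
    have [irr' _] := uz'.
    have [k [e' he']] : exists k, divides (u k)%:P (zemb p z').
      apply: NNPP => none; apply: (@unramified_hp z' irr').
        by move=> k d; apply: none; exists k.
      have /dvdpP[v ->] : u i %| h ^+ p.
        rewrite -(prednK p_gt0) exprS; apply: dvdp_mulr.
        exact: factor_dvd alpha_gt0 h_fact i.
      by exists (e * v%:P); rewrite mulrC polyCM he mulrA.
    have ki : k = i.
      apply: (factor_dvd_eq u_monic u_irr u_inj).
      have /dividesC/(_ 0%N) : divides (u k)%:P (u i)%:P.
        by exists (e' * e); rewrite mulrA -he'.
      by rewrite coefC.
    by rewrite (@unramified_factor_ideal z' i uz') // -ki; exists e'.
  + have := sub _ (gen_ideal_self h _); rewrite {1}zevalE => /gen_idealC_divides d.
    by rewrite (unramified_factor_ideal uz d).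
  (* An irreducible central element dividing another one is its associate. *)
  + have := sub _ (gen_ideal_self h _); rewrite !zevalE.
    have [irr [zn0 zN irr']] := (uz'.1, uz.1).
    case/(gen_ideal_centralP _ (zemb_central p_char z'))/(zemb_divides irr) => e z_eq w.
    case/(gen_ideal_central _ (zemb_central p_char z')) => b [e' ->] ->.
    apply/gen_ideal_centralP; first exact: zemb_central.
    case: (irr' _ _ z_eq) => [|eU]; first by case: irr => _ /negPf ->.
    have -> : z' = z * e^-1 by rewrite z_eq mulrK.
    by exists (zemb p e^-1 * e'); rewrite zembM mulrA.
split=> [/f[_ [[[i ->]|[z [uz ->]]] e]]|[[i e]|[z [uz e]]]].
- by left; exists i.
- by right; exists z.
- by apply: g; exists (gen_ideal h (u i)%:P); split=> //; left; exists i.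
- by apply: g; exists (gen_ideal h (zeval h p z)); split=> //; right; exists z.
Qed.

End Listed.
End WeylCharP.

Theorem theorem7p6 (F : fieldType) (h : {poly F}) (lam : F) (t : nat)
    (u : 'I_t -> {poly F}) (alpha : 'I_t -> nat) :
  h != 0 -> lam != 0 ->
  (forall i, u i \is monic) -> (forall i, irreducible_poly (u i)) ->
  injective u -> (forall i, (0 < alpha i)%N) ->
  h = lam%:P * \prod_(i < t) u i ^+ alpha i ->
  [/\ (forall i, height_one h (gen_ideal h (u i)%:P) /\
                 quotient_domain h (gen_ideal h (u i)%:P)),
      ([pchar F] =i pred0 ->
         forall P, height_one h P <-> exists i, set_eq P (gen_ideal h (u i)%:P)) &
      (forall p, p \in [pchar F] ->
         (forall z : {poly {poly F}}, irreducible_elt z ->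
            (forall i xi, xi != 0 -> zeval h p z <> (xi *: u i ^+ p)%:P) ->
            height_one h (gen_ideal h (zeval h p z))) /\
         (forall P, height_one h P <->
            ((exists i, set_eq P (gen_ideal h (u i)%:P)) \/
             (exists z : {poly {poly F}}, [/\ irreducible_elt z,
                (forall i xi, xi != 0 -> zeval h p z <> (xi *: u i ^+ p)%:P) &
                set_eq P (gen_ideal h (zeval h p z))]))))].
Proof.
move=> h_neq0 lam_neq0 u_monic u_irr u_inj alpha_gt0 h_fact.
have char0 := height_one_char0 h_neq0 u_monic u_irr u_inj alpha_gt0 h_fact.
have charp p (p_char : p \in [pchar F]) :=
  height_one_pchar p_char h_neq0 u_monic u_irr u_inj alpha_gt0 h_fact.
split=> //.
- move=> i; split; last exact: factor_domain (u_irr i) (factor_dvd alpha_gt0 h_fact i).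
  (* Height one of [u i A_h] is read off from the classification that applies to the characteristic
     of [F]. *)
  have [[p p_char]|no_char] := classic (exists p, p \in [pchar F]).
    by apply/(charp p p_char); left; exists i.
  apply/char0; last by exists i.
  by move=> p; rewrite !inE; apply/negbTE/negP => p_char; apply: no_char; exists p.
- move=> p p_char; split=> [z irr nr|P].
    by apply/(charp p p_char); right; exists z.
  rewrite (charp p p_char P); split=> -[?|]; [by left| |by left|].
    by case=> z [[irr nr] e]; right; exists z.
  by case=> z [irr nr e]; right; exists z.
Qed.
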